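(* Let $G$ be a group acting faithfully on a countable set $S$. Then the twisted Brin--Thompson group $\mathrm{SV}_G$ is boundedly acyclic.
   Context: **Twisted Brin--Thompson groups (Belk--Zaremsky).** Let $\mathfrak{C}=\{0,1\}^\omega$ be the Cantor set and $\mathfrak{C}^S$ the product space, viewed as the set of functions $\kappa:S\to\mathfrak{C}$. For a function $\psi:S\to\{0,1\}^{<\omega}$ (finite words) with $\psi(s)$ equal to the empty word for all but finitely many $s$, the dyadic brick $B(\psi)$ is $\{\kappa\in\mathfrak{C}^S: \psi(s)\text{ is a prefix of }\kappa(s)\text{ for all }s\in S\}$, and $h_\psi:\mathfrak{C}^S\to B(\psi)$ is the canonical homeomorphism $h_\psi(\kappa)(s)=\psi(s)\kappa(s)$ (concatenation). For $\gamma\in G$ let $\tau_\gamma:\mathfrak{C}^S\to\mathfrak{C}^S$ be the homeomorphism permuting the coordinates via $\gamma$, i.e. $\tau_\gamma(\kappa)(s)=\kappa(\gamma^{-1}s)$. The group $\mathrm{SV}_G$ consists of all homeomorphisms $h$ of $\mathfrak{C}^S$ for which there are two partitions of $\mathfrak{C}^S$ into dyadic bricks $B(\varphi_1),\dots,B(\varphi_n)$ and $B(\psi_1),\dots,B(\psi_n)$ and elements $\gamma_1,\dots,\gamma_n\in G$ such that $h|_{B(\varphi_i)}=h_{\psi_i}\circ\tau_{\gamma_i}\circ h_{\varphi_i}^{-1}$ for each $i$. A group $\Gamma$ (viewed as a discrete group) is boundedly acyclic if its bounded cohomology $\mathrm{H}_b^i(\Gamma,\mathbb{R})=0$ for all $i\ge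 1$. *)

(* Defs.v *)
From HB Require Import structures.
From mathcomp Require Import all_boot all_order all_algebra.
From mathcomp Require Import boolp classical_sets functions cardinality reals.
From mathcomp Require Import topology cantor.

Set Implicit Arguments.
Unset Strict Implicit.
Unset Printing Implicit Defensive.

Import Order.TTheory GRing.Theory Num.Theory.

Local Open Scope classical_set_scope.

(** * Homeomorphism groups *)

Record homeo (X : topologicalType) := Homeo {
  homeo_fun :> X -> X;
  homeo_inv : X -> X;
  homeo_funK : cancel homeo_fun homeo_inv;
  homeo_invK : cancel homeo_inv homeo_fun;
  homeo_fun_continuous : continuous homeo_fun;
  homeo_inv_continuous : continuous homeo_inv }.

Section HomeoGroup.
Variable X : topologicalType.
Implicit Types f g h : homeo X.

Lemma homeo_ext f g : f =1 g -> f = g.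
Proof.
case: f g => [f f' fK f'K cf cf'] [g g' gK g'K cg cg'] /= /funext fg.
move: fK f'K cf; rewrite fg => fK f'K cf.
have f'g' : f' = g' by apply/funext => x; apply: (can_inj gK); rewrite f'K g'K.
move: fK f'K cf'; rewrite f'g' => fK f'K cf'.
by congr Homeo; exact: Prop_irrelevance.
Qed.

Definition homeo_id : homeo X :=
  @Homeo X id id (fun=> erefl) (fun=> erefl)
    (fun x => cvg_id) (fun x => cvg_id).

Definition homeo_sym f : homeo X :=
  @Homeo X (homeo_inv f) f (@homeo_invK X f) (@homeo_funK X f)
    (@homeo_inv_continuous X f) (@homeo_fun_continuous X f).

Lemma homeo_comp_continuous f g : continuous (f \o g).
Proof.
move=> x; apply: continuous_comp; first exact: (@homeo_fun_continuous X g).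
exact: (@homeo_fun_continuous X f).
Qed.

Definition homeo_comp f g : homeo X :=
  @Homeo X (f \o g) (homeo_inv g \o homeo_inv f)
    (can_comp (@homeo_funK X f) (@homeo_funK X g))
    (can_comp (@homeo_invK X g) (@homeo_invK X f))
    (@homeo_comp_continuous f g)
    (@homeo_comp_continuous (homeo_sym g) (homeo_sym f)).

HB.instance Definition _ := gen_eqMixin (homeo X).
HB.instance Definition _ := gen_choiceMixin (homeo X).

Lemma homeo_compA : associative homeo_comp.
Proof. by move=> f g h; exact: homeo_ext. Qed.

Lemma homeo_comp1 : left_id homeo_id homeo_comp.
Proof. by move=> f; exact: homeo_ext. Qed.

Lemma homeo_1comp : right_id homeo_id homeo_comp.
Proof. by move=> f; exact: homeo_ext. Qed.

Lemma homeo_compV : left_inverse homeo_id homeo_sym homeo_comp.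
Proof. by move=> f; apply: homeo_ext => x /=; rewrite homeo_funK. Qed.

Lemma homeo_Vcomp : right_inverse homeo_id homeo_sym homeo_comp.
Proof. by move=> f; apply: homeo_ext => x /=; rewrite homeo_invK. Qed.

HB.instance Definition _ := isGroup.Build (homeo X)
  homeo_compA homeo_comp1 homeo_1comp homeo_compV homeo_Vcomp.

End HomeoGroup.

(** * Actions of possibly infinite groups on sets *)

Record group_action (G : groupType) (S : Type) := GroupAction {
  act :> G -> S -> S;
  act1 : forall s, act 1%g s = s;
  actM : forall g h s, act (g * h)%g s = act g (act h s) }.

Definition faithful_action (G : groupType) (S : Type) (a : group_action G S) :=
  forall g, (forall s, a g s = s) -> g = 1%g.

(** * Dyadic bricks of the Cantor cube *)

Definition cantor_cube (S : Type) := prod_topology (fun _ : S => cantor_space).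

HB.instance Definition _ (S : Type) := Topological.on (cantor_cube S).

Definition is_prefix (w : seq bool) (x : cantor_space) :=
  forall k, (k < size w)%N -> nth false w k = x k.

Definition wcat (w : seq bool) (x : cantor_space) : cantor_space :=
  fun k => if (k < size w)%N then nth false w k else x (k - size w)%N.

Definition wdrop (n : nat) (x : cantor_space) : cantor_space :=
  fun k => x (n + k)%N.

Record brick_index (S : Type) := BrickIndex {
  brick_word :> S -> seq bool;
  brick_word_finite : finite_set [set s | brick_word s <> [::]] }.

Section Bricks.
Variable S : Type.
Implicit Types (p q e : brick_index S) (x y : cantor_cube S).

Definition brick p : set (cantor_cube S) :=
  [set x | forall s, is_prefix (p s) (x s)].

Definition brick_map p x : cantor_cube S := fun s => wcat (p s) (x s).

(* The inverse of [brick_map p] on [brick p]: drop the prefix [p s]. *)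
Definition brick_map_inv p x : cantor_cube S :=
  fun s => wdrop (size (p s)) (x s).

Lemma brick_map_in p x : brick p (brick_map p x).
Proof. by move=> s k kp; rewrite /brick_map /wcat kp. Qed.

Lemma brick_mapK p : cancel (brick_map p) (brick_map_inv p).
Proof.
move=> x; apply/funext => s; apply/funext => k.
by rewrite /brick_map_inv /wdrop /brick_map /wcat ltnNge leq_addr /= addKn.
Qed.

Lemma brick_map_invK p x : brick p x -> brick_map p (brick_map_inv p x) = x.
Proof.
move=> px; apply/funext => s; apply/funext => k.
rewrite /brick_map /wcat /brick_map_inv /wdrop.
by case: ltnP => [/px//|le]; rewrite subnKC.
Qed.

End Bricks.

(** * Twisted Brin-Thompson groups *)

Section Twist.
Variables (G : groupType) (S : Type) (a : group_action G S).

Definition twist (g : G) (x : cantor_cube S) : cantor_cube S :=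
  fun s => x (a g^-1%g s).

Definition twisted_brin_thompson (h : cantor_cube S -> cantor_cube S) : Prop :=
  exists (n : nat) (p q : 'I_n -> brick_index S) (g : 'I_n -> G),
    [/\ partition [set: 'I_n] (fun i => brick (p i)) [set: cantor_cube S],
        partition [set: 'I_n] (fun i => brick (q i)) [set: cantor_cube S] &
        forall i, {in brick (p i),
          h =1 brick_map (q i) \o twist (g i) \o brick_map_inv (p i)}].

Definition SV_pred : {pred homeo (cantor_cube S)} :=
  fun h => `[< twisted_brin_thompson h >].

Record SV := MakeSV { SV_val :> homeo (cantor_cube S); _ : SV_val \in SV_pred }.

HB.instance Definition _ := [isSub for SV_val].
HB.instance Definition _ := [Choice of SV by <:].

Implicit Types (p q e : brick_index S) (x y z : cantor_cube S).
Implicit Types (h : homeo (cantor_cube S)).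

Lemma twist1 : twist 1%g = id.
Proof. by apply/funext => x; apply/funext => s; rewrite /twist invg1 act1. Qed.

Lemma twistM g g' x : twist (g * g')%g x = twist g (twist g' x).
Proof. by apply/funext => s; rewrite /twist invgM actM. Qed.

Lemma twistK g : cancel (twist g) (twist g^-1%g).
Proof. by move=> x; rewrite -twistM mulVg twist1. Qed.

Lemma twistVK g : cancel (twist g^-1%g) (twist g).
Proof. by move=> x; rewrite -twistM mulgV twist1. Qed.

(* The empty index, extension of an index, and the translate of an index. *)
Lemma brick_index0_subproof : finite_set [set s : S | [::] <> [::] :> seq bool].
Proof. by rewrite (_ : mkset _ = set0) //; apply/seteqP; split. Qed.

Definition brick_index0 := BrickIndex brick_index0_subproof.

Lemma brick_index_cat_subproof (p e : brick_index S) :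
  finite_set [set s | p s ++ e s <> [::]].
Proof.
apply: (@sub_finite_set _ _
  ([set s | p s <> [::]] `|` [set s | e s <> [::]])) => [s /=|].
  by case: (p s) => [|b w] /= ?; [right|left].
by rewrite finite_setU; split; exact: brick_word_finite.
Qed.

Definition brick_index_cat (p e : brick_index S) :=
  BrickIndex (brick_index_cat_subproof p e).

Lemma brick_index_act_subproof (g : G) (e : brick_index S) :
  finite_set [set s | e (a g^-1%g s) <> [::]].
Proof.
apply: (@sub_finite_set _ _ (a g @` [set s | e s <> [::]])) => [s /= es|].
  by exists (a g^-1%g s) => //; rewrite -actM mulgV act1.
exact/finite_image/brick_word_finite.
Qed.

Definition brick_index_act (g : G) (e : brick_index S) :=
  BrickIndex (brick_index_act_subproof g e).

Lemma brick_index_drop_subproof (p q : brick_index S) :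
  finite_set [set s | drop (size (p s)) (q s) <> [::]].
Proof.
apply: (@sub_finite_set _ _ [set s | q s <> [::]]) => [s /=|].
  by case: (q s).
exact: brick_word_finite.
Qed.

Definition brick_index_drop (p q : brick_index S) :=
  BrickIndex (brick_index_drop_subproof p q).

Lemma brick_index0E : brick_map brick_index0 = id.
Proof.
apply/funext => x; apply/funext => s; apply/funext => k.
by rewrite /brick_map /wcat /= subn0.
Qed.

Lemma brick_map_cat p e x :
  brick_map (brick_index_cat p e) x = brick_map p (brick_map e x).
Proof.
apply/funext => s; apply/funext => k.
rewrite /brick_map /wcat /= size_cat nth_cat.
case: (ltnP k (size (p s))) => kp; first by rewrite ltn_addr.
by rewrite ltn_subLR // subnDA.
Qed.

Lemma twist_brick_map g e x :
  twist g (brick_map e x) = brick_map (brick_index_act g e) (twist g x).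
Proof. by []. Qed.

Lemma brickP p x : brick p x <-> exists y, x = brick_map p y.
Proof.
split=> [px|[y ->]]; last exact: brick_map_in.
by exists (brick_map_inv p x); rewrite brick_map_invK.
Qed.

Lemma brick_map_inj p : injective (brick_map p).
Proof. exact: can_inj (@brick_mapK S p). Qed.

Lemma brick_cat_map p e x :
  brick (brick_index_cat p e) (brick_map p x) <-> brick e x.
Proof.
split=> /brickP[y].
  by rewrite brick_map_cat => /brick_map_inj ->; exact: brick_map_in.
by move=> ->; rewrite -brick_map_cat; exact: brick_map_in.
Qed.

Lemma brick_act g e x : brick (brick_index_act g e) (twist g x) <-> brick e x.
Proof.
split=> [ex s k ks|ex s]; last exact: ex.
have /(_ k) := ex (a g s).
by rewrite /twist /= -actM mulVg act1; exact.
Qed.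

Lemma is_prefix_take w (z : cantor_space) n : is_prefix w z -> is_prefix (take n w) z.
Proof.
move=> wz k; rewrite size_take_min leq_min => /andP[kn kw].
by rewrite nth_take // wz.
Qed.

Lemma is_prefix_eq_take w v (z : cantor_space) : is_prefix w z -> is_prefix v z ->
  (size w <= size v)%N -> w = take (size w) v.
Proof.
move=> wz vz wv; apply: (@eq_from_nth _ false) => [|k kw].
  by rewrite size_takel.
by rewrite nth_take // wz // vz // (leq_trans kw wv).
Qed.

Lemma is_prefix_join w v (z : cantor_space) : is_prefix w z -> is_prefix v z ->
  w ++ drop (size w) v = if (size w <= size v)%N then v else w.
Proof.
move=> wz vz; case: leqP => [wv|/ltnW vw]; last by rewrite drop_oversize ?cats0.
by rewrite {1}(is_prefix_eq_take wz vz wv) cat_take_drop.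
Qed.

Lemma brick_cat_drop p q z x : brick p z -> brick q z ->
  brick (brick_index_cat p (brick_index_drop p q)) x <-> brick p x /\ brick q x.
Proof.
move=> pz qz; split=> [pqx|[px qx] s]; last first.
  by rewrite /= (is_prefix_join (pz s) (qz s)); case: ifP.
split=> s; have := pqx s; rewrite /= (is_prefix_join (pz s) (qz s)).
  case: leqP => // pq /(@is_prefix_take _ _ (size (p s))).
  by rewrite -(is_prefix_eq_take (pz s) (qz s) pq).
case: leqP => // /ltnW pq /(@is_prefix_take _ _ (size (q s))).
by rewrite -(is_prefix_eq_take (qz s) (pz s) pq).
Qed.

Lemma brick_map_cat_dropC p q z x : brick p z -> brick q z ->
  brick_map (brick_index_cat p (brick_index_drop p q)) x =
  brick_map (brick_index_cat q (brick_index_drop q p)) x.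
Proof.
move=> pz qz; apply/funext => s; rewrite /brick_map /=; congr wcat.
rewrite (is_prefix_join (pz s) (qz s)) (is_prefix_join (qz s) (pz s)).
have [pq|qp|eqs] := ltngtP (size (p s)) (size (q s)) => //.
by rewrite [RHS](is_prefix_eq_take (pz s) (qz s)) ?eqs // take_size.
Qed.

Lemma brick_partitionP (I : Type) (p : I -> brick_index S) :
  partition [set: I] (fun i => brick (p i)) [set: cantor_cube S] <->
  forall x, exists! i, brick (p i) x.
Proof.
split=> [[cov triv _] x|pE].
  have : cover [set: I] (fun i => brick (p i)) x by rewrite cov.
  by move=> [i _ ix]; exists i; split => // j jx; apply: triv => //; exists x.
split=> [||i _].
- by apply/seteqP; split => // x _; have [i [ix _]] := pE x; exists i.
- move=> i j _ _ [x [ix jx]]; have [k [_ kx]] := pE x.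
  by rewrite -(kx _ ix) -(kx _ jx).
- by exists (brick_map (p i) (fun _ _ => false)); exact: brick_map_in.
Qed.

Definition twist_piece (h : cantor_cube S -> cantor_cube S) p (g : G) q :=
  forall x, h (brick_map p x) = brick_map q (twist g x).

Lemma twist_pieceP (h : cantor_cube S -> cantor_cube S) p g q :
  {in brick p, h =1 brick_map q \o twist g \o brick_map_inv p} <->
  twist_piece h p g q.
Proof.
split=> [hp x|hp x /set_mem/brickP[y ->]].
  by rewrite hp /= ?brick_mapK // inE; exact: brick_map_in.
by rewrite hp /= brick_mapK.
Qed.

Lemma twist_piece_brick h p g q x :
  twist_piece h p g q -> brick q (h x) <-> brick p x.
Proof.
move=> hp; split=> /brickP[y]; last by move=> ->; rewrite hp; exact: brick_map_in.
rewrite -(twistVK g y) -hp => /(can_inj (@homeo_funK _ h)) ->.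
exact: brick_map_in.
Qed.

Lemma SV_predP h :
  (exists (I : finType) (p q : I -> brick_index S) (g : I -> G),
    (forall x, exists! i, brick (p i) x) /\
    (forall i, twist_piece h (p i) (g i) (q i))) <->
  h \in SV_pred.
Proof.
split=> [[I [p [q [g [pE hE]]]]]|/asboolP[n [p [q [g [pE _ hE]]]]]]; last first.
  exists 'I_n, p, q, g; split; first exact/brick_partitionP.
  by move=> i; exact/twist_pieceP.
apply/asboolP; exists #|I|, (p \o enum_val), (q \o enum_val), (g \o enum_val).
have p'E x : exists! i : 'I_#|I|, brick (p (enum_val i)) x.
  have [i [ix iE]] := pE x; exists (enum_rank i).
  by split=> [|j /iE ->]; rewrite ?enum_rankK ?enum_valK.
split; first exact/brick_partitionP.
- apply/brick_partitionP => y; have [i [iy iE]] := p'E (homeo_inv h y).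
  rewrite -(homeo_invK h y); exists i; split=> [|j].
    exact/(twist_piece_brick _ (hE _)).
  by move/(twist_piece_brick _ (hE _)) => /iE.
- by move=> i; apply/twist_pieceP/hE.
Qed.

Lemma SV_pred1 : (1%g : homeo (cantor_cube S)) \in SV_pred.
Proof.
apply/SV_predP; exists unit, (fun=> brick_index0), (fun=> brick_index0).
exists (fun=> 1%g); split=> [x|_ x]; last by rewrite brick_index0E twist1.
by exists tt; split=> [s []//|[]].
Qed.

Lemma SV_predV h : h \in SV_pred -> h^-1%g \in SV_pred.
Proof.
move/SV_predP => [I [p [q [g [pE hE]]]]].
apply/SV_predP; exists I, q, p, (fun i => (g i)^-1%g); split=> [y|i y].
  have [i [iy iE]] := pE (homeo_inv h y).
  rewrite -(homeo_invK h y); exists i; split=> [|j].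
    exact/(twist_piece_brick _ (hE _)).
  by move/(twist_piece_brick _ (hE _)) => /iE.
apply: (can_inj (@homeo_funK _ h)).
by rewrite hE twistVK; exact: homeo_invK.
Qed.

Lemma SV_predM h h' :
  h \in SV_pred -> h' \in SV_pred -> (h * h')%g \in SV_pred.
Proof.
move=> /SV_predP[J [p' [q' [g' [p'E hE]]]]] /SV_predP[I [p [q [g [pE h'E]]]]].
pose meets (k : I * J) :=
  `[< exists z, brick (q k.1) z /\ brick (p' k.2) z >].
pose K : finType := {k : I * J | meets k}.
pose i (k : K) := (val k).1; pose j (k : K) := (val k).2.
pose e k := brick_index_drop (q (i k)) (p' (j k)).
pose e' k := brick_index_drop (p' (j k)) (q (i k)).
apply/SV_predP; exists K.
exists (fun k => brick_index_cat (p (i k)) (brick_index_act (g (i k))^-1%g (e k))).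
exists (fun k => brick_index_cat (q' (j k)) (brick_index_act (g' (j k)) (e' k))).
exists (fun k => g' (j k) * g (i k))%g.
have pieceE k : twist_piece h'
    (brick_index_cat (p (i k)) (brick_index_act (g (i k))^-1%g (e k))) (g (i k))
    (brick_index_cat (q (i k)) (e k)).
  move=> x; rewrite !brick_map_cat h'E.
  by rewrite -{1}(twistK (g (i k)) x) -twist_brick_map twistVK.
split=> [x|k x]; last first.
  have [z [qz pz]] := asboolP _ (valP k).
  rewrite [LHS]/= pieceE (brick_map_cat_dropC _ qz pz) !brick_map_cat hE.
  by rewrite twist_brick_map twistM.
have srcE k : brick
    (brick_index_cat (p (i k)) (brick_index_act (g (i k))^-1%g (e k))) x <->
    brick (p (i k)) x /\ brick (p' (j k)) (h' x).
  have [z [qz pz]] := asboolP _ (valP k).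
  rewrite -(twist_piece_brick _ (pieceE k)) -(twist_piece_brick _ (h'E (i k))).
  exact: brick_cat_drop qz pz.
have [i0 [i0x i0E]] := pE x; have [j0 [j0x j0E]] := p'E (h' x).
have meets0 : meets (i0, j0).
  apply/asboolP; exists (h' x); split=> //=.
  exact/(twist_piece_brick _ (h'E i0)).
exists (exist _ (i0, j0) meets0 : K); split; first exact/srcE.
by move=> k /srcE[/i0E ik /j0E jk]; apply: val_inj; rewrite /= ik jk -surjective_pairing.
Qed.

Lemma SV_group_closed : group_closed SV_pred.
Proof.
split; first exact: SV_pred1.
by move=> h h' hS h'S; apply: SV_predM => //; exact: SV_predV.
Qed.

HB.instance Definition _ := SubChoice_isSubGroup.Build _ _ SV SV_group_closed.

End Twist.

(** * Bounded cohomology *)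

Section BoundedCohomology.
Variables (R : realType) (G : groupType).
Local Open Scope ring_scope.

(* Homogeneous cochains of degree [n] are functions of [n.+1] variables. *)
Definition cochain (n : nat) := ('I_n.+1 -> G) -> R.

HB.instance Definition _ n := GRing.Zmodule.on (cochain n).

Definition bounded_cochains (n : nat) : set (cochain n) :=
  [set c | (forall g x, c (fun i => (g * x i)%g) = c x) /\
           exists M : R, forall x, `|c x| <= M].
#[global] Arguments bounded_cochains : clear implicits.

Definition coboundary (n : nat) (c : cochain n) : cochain n.+1 :=
  fun x => \sum_(i < n.+2) (-1) ^+ i * c (x \o lift i).

Definition bounded_cocycles (n : nat) : set (cochain n) :=
  [set c | bounded_cochains n c /\ coboundary c = 0].
#[global] Arguments bounded_cocycles : clear implicits.

Definition bounded_coboundaries (n : nat) : set (cochain n) :=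
  match n with
  | 0 => [set 0]
  | m.+1 => @coboundary m @` bounded_cochains m
  end.
#[global] Arguments bounded_coboundaries : clear implicits.

Definition bounded_class (n : nat) (c : cochain n) : set (cochain n) :=
  [set c + b | b in bounded_coboundaries n].

(* The quotient of cocycles by coboundaries, as its set of cosets. *)
Definition bounded_cohomology (n : nat) : set (set (cochain n)) :=
  @bounded_class n @` bounded_cocycles n.
#[global] Arguments bounded_cohomology : clear implicits.

Definition boundedly_acyclic :=
  forall n, (0 < n)%N -> bounded_cohomology n = [set bounded_class 0].

End BoundedCohomology.

(* Main.v *)
(** The proof is an induction on the degree, simultaneous for all the groups
    [H_U] of elements supported in a clopen set [U] and with uniform bounds.
    [H_U] acts on tuples of germs of group elements at a base point, moved to
    distinct points of [U]; it is transitive on tuples of each length, and the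
    stabiliser of a tuple is an increasing union of groups [H_V], whose bounded
    cohomology vanishes below degree [n] by induction.  In the resulting double
    complex a degree [n] class of [H_U] is therefore determined, with control of
    norms, by its restriction to the stabiliser of one germ.  On [H_V] with
    [V] small, let [phi] be the product of [N] conjugations of [H_V] onto groups
    with disjoint supports in [U]: by a Kunneth argument [phi^* c] is
    cohomologous to [N c], whereas its norm is at most that of [c].  Taking [N]
    large shows that every class has a representative of half the norm, and
    iterating gives a bounded primitive. *)

(* Cochains are functions on lists of length [q], that is, homogeneous cochains of degree [q - 1] in
   the augmented complex, so the induction starts at length 0, where vanishing is automatic. Germs
   are moved around rather than points because an element fixing a germ is the identity on a clopen
   neighbourhood of the base point of that germ, hence lies in some [H_V]; fixing a point gives no
   such neighbourhood. Bounded cohomology does not commute with increasing unions, since primitives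
   found on the members may grow; bounds uniform in the support allow an ultralimit of them instead.
   The gain in norm lies in an order of quantifiers: the bound on the new representative of [N c] is
   fixed before [N], and only the primitive pays for a large [N]. *)
From HB Require Import structures.
Require Import Defs.
From mathcomp Require Import all_boot all_order all_algebra.
From mathcomp Require Import mathcomp_extra boolp classical_sets functions.
From mathcomp Require Import cardinality reals topology function_spaces.
From mathcomp Require Import normedtype cantor lra.

Set Implicit Arguments.
Unset Strict Implicit.
Unset Printing Implicit Defensive.

Import Order.TTheory GRing.Theory Num.Theory.
Import numFieldNormedType.Exports.

Local Open Scope classical_set_scope.
Local Open Scope ring_scope.

(** * The augmented homogeneous complex on lists, cones and prisms *)

Section Coboundary.
Variable R : realType.

(** The alternating sum over the deletions of one entry, written recursively so that its identities
    follow by induction on the list. The augmentation is [cobd f [:: x] = f [::]]. *)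
Fixpoint cobd (T : Type) (f : seq T -> R) (s : seq T) : R :=
  if s is x :: s' then f s' - cobd (fun u => f (x :: u)) s' else 0.

(** The faces that [cobd] inspects. Hypotheses on [f] restricted to faces let a genericity condition
    pass through [cobd]. *)
Inductive del (T : Type) : seq T -> seq T -> Prop :=
| del_head x s : del s (x :: s)
| del_cons x u s : del u s -> del (x :: u) (x :: s).

Section OneType.
Variable T : Type.
Implicit Types (f g : seq T -> R) (s u : seq T) (x : T).

Lemma del_size u s : del u s -> size s = (size u).+1.
Proof. by elim=> //= x v t _ ->. Qed.

Lemma cobd_ext f g s : (forall u, del u s -> f u = g u) -> cobd f s = cobd g s.
Proof.
elim: s f g => //= x s IH f g fg; rewrite fg; last exact: del_head.
by rewrite (IH _ (fun u => g (x :: u))) // => u us; apply: fg; exact: del_cons.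
Qed.

Lemma cobd_ext_size f g n s : size s = n.+1 ->
  (forall u, size u = n -> f u = g u) -> cobd f s = cobd g s.
Proof. by move=> sn fg; apply: cobd_ext => u /del_size; rewrite sn => -[/esym/fg]. Qed.

Lemma cobdD f g s : cobd (fun u => f u + g u) s = cobd f s + cobd g s.
Proof.
elim: s f g => [|x s IH] f g /=; first by rewrite addr0.
by rewrite IH opprD addrACA.
Qed.

Lemma cobdZ k f s : cobd (fun u => k * f u) s = k * cobd f s.
Proof.
elim: s f => [|x s IH] f /=; first by rewrite mulr0.
by rewrite (IH (fun u => f (x :: u))) mulrBr.
Qed.

Lemma cobdN f s : cobd (fun u => - f u) s = - cobd f s.
Proof.
under [LHS]cobd_ext do rewrite -mulN1r.
by rewrite cobdZ mulN1r.
Qed.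

Lemma cobdB f g s : cobd (fun u => f u - g u) s = cobd f s - cobd g s.
Proof. by rewrite cobdD cobdN. Qed.

Lemma cobd0 s : cobd (fun=> 0) s = 0.
Proof. by elim: s => //= x s ->; rewrite subr0. Qed.

Lemma cobdK f s : cobd (cobd f) s = 0.
Proof.
elim: s f => //= x s IH f.
by rewrite cobdB IH subr0 subrr.
Qed.

Lemma cobd_cst k s : cobd (fun=> k) s = if odd (size s) then k else 0.
Proof. by elim: s => //= x s ->; case: odd; rewrite ?subr0 ?subrr. Qed.

Lemma cobd_bound f M s : (forall u, del u s -> `|f u| <= M) ->
  `|cobd f s| <= (size s)%:R * M.
Proof.
elim: s f => [|x s IH] f fM /=; first by rewrite normr0 mul0r.
rewrite mulrS mulrDl mul1r (le_trans (ler_normB _ _)) // lerD //.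
  exact/fM/del_head.
by apply: IH => u us; apply: fM; exact: del_cons.
Qed.

(** Coning with vertex [x] is a contracting homotopy. The exactness proofs below look for a vertex,
    possibly depending on the other variables, that keeps the cone invariant. *)
Lemma cobd_cone f x s : f s = cobd (fun u => f (x :: u)) s + cobd f (x :: s).
Proof. by rewrite /= addrCA subrr addr0. Qed.

End OneType.

Lemma del_map (T T' : Type) (a : T -> T') u s : del u (map a s) ->
  exists2 v, del v s & u = map a v.
Proof.
elim: s u => [|x s IH] u /= us; inversion us; subst.
  by exists s => //; exact: del_head.
have [v vs ->] := IH _ H1.
by exists (x :: v) => //; exact: del_cons.
Qed.

Lemma cobd_map (T T' : Type) (a : T -> T') (f : seq T' -> R) s :
  cobd f (map a s) = cobd (fun u => f (map a u)) s.
Proof. by elim: s f => //= x s IH f; rewrite IH. Qed.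

Lemma cobdC (T T' : Type) (f : seq T -> seq T' -> R) ys xs :
  cobd (fun v => cobd (f v) xs) ys = cobd (fun u => cobd (fun v => f v u) ys) xs.
Proof.
elim: ys f => [|y ys IH] f /=; first by rewrite cobd0.
by rewrite cobdB (IH (fun v => f (y :: v))).
Qed.

Section Prism.
Variables T T' : Type.
Implicit Types (a b : T -> T') (f g : seq T' -> R) (s : seq T).

(** The alternating sum of [f] over the lists [a x_0, ..., a x_i, b x_i, ..., b x_k]: the chain
    homotopy between the pullbacks along [a] and [b]. It costs a factor linear in the length. *)
Fixpoint prism a b f s : R :=
  if s is x :: s' then
    f (a x :: b x :: map b s') - prism a b (fun u => f (a x :: u)) s'
  else 0.

Lemma prismB a b f g s :
  prism a b (fun u => f u - g u) s = prism a b f s - prism a b g s.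
Proof.
elim: s f g => [|x s IH] f g /=; first by rewrite subr0.
rewrite (IH (fun u => f (a x :: u)) (fun u => g (a x :: u))).
by lra.
Qed.

Lemma prism_ext a b f g s : (forall u, size u = (size s).+1 -> f u = g u) ->
  prism a b f s = prism a b g s.
Proof.
elim: s f g => //= x s IH f g fg; rewrite fg /= ?size_map //.
by congr (_ - _); apply: IH => u su; apply: fg; rewrite /= su.
Qed.

Lemma prism0 a b s : prism a b (fun=> 0) s = 0.
Proof. by elim: s => //= x s ->; rewrite subr0. Qed.

Lemma prismE a b f s :
  f (map b s) - f (map a s) = cobd (prism a b f) s + prism a b (cobd f) s.
Proof.
elim: s f => [|x s IH] f /=; first by rewrite subrr addr0.
have := IH (fun u => f (a x :: u)).
rewrite (prismB a b f (cobd (fun u => f (a x :: u)))).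
rewrite (cobdB (fun u => f [:: a x, b x & map b u])).
rewrite (cobd_map b (fun u => f [:: a x, b x & u])) /=.
lra.
Qed.

Lemma prism_homotopy a b f n : (forall u, size u = n.+1 -> cobd f u = 0) ->
  forall s, size s = n -> f (map b s) - f (map a s) = cobd (prism a b f) s.
Proof.
move=> f0 s sn; rewrite prismE (@prism_ext _ _ _ (fun=> 0)) ?prism0 ?addr0 //.
by move=> u; rewrite sn; exact: f0.
Qed.

Lemma prism_bound a b f M s : (forall u, size u = (size s).+1 -> `|f u| <= M) ->
  `|prism a b f s| <= (size s)%:R * M.
Proof.
elim: s f => [|x s IH] f fM /=; first by rewrite normr0 mul0r.
rewrite mulrS mulrDl mul1r (le_trans (ler_normB _ _)) // lerD //.
  by apply: fM; rewrite /= size_map.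
by apply: IH => u su; apply: fM; rewrite /= su.
Qed.

Lemma prism_map a b f s (h : T -> T) (h' : T' -> T') :
  (forall x, a (h x) = h' (a x)) -> (forall x, b (h x) = h' (b x)) ->
  prism a b f (map h s) = prism a b (fun u => f (map h' u)) s.
Proof.
move=> ah bh; elim: s f => //= x s IH f.
by rewrite ah bh -map_comp (eq_map bh) map_comp IH.
Qed.

End Prism.

End Coboundary.

(** * Limits along directed preorders *)

Section DirectedLimit.
Variables (R : realType) (I : Type) (le : I -> I -> Prop).
Hypothesis le_refl : forall i, le i i.
Hypothesis le_trans : forall i j k, le i j -> le j k -> le i k.
Hypothesis le_dir : forall i j, exists k, le i k /\ le j k.
Variable i0 : I.

Definition ultimately (P : I -> Prop) := exists i, forall j, le i j -> P j.

Lemma ultimatelyW (P Q : I -> Prop) : (forall i, P i -> Q i) ->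
  ultimately P -> ultimately Q.
Proof. by move=> PQ [i Pi]; exists i => j /Pi/PQ. Qed.

Lemma ultimatelyT (P : I -> Prop) : (forall i, P i) -> ultimately P.
Proof. by move=> Pi; exists i0. Qed.

Lemma ultimatelyI (P Q : I -> Prop) :
  ultimately P -> ultimately Q -> ultimately (fun i => P i /\ Q i).
Proof.
move=> [i Pi] [j Qj]; have [k [ik jk]] := le_dir i j.
by exists k => l kl; split; [apply: Pi|apply: Qj]; exact: le_trans kl.
Qed.

Definition tails : set_system I := [set A | ultimately A].

Instance tails_proper : ProperFilter tails.
Proof.
split; first by move=> [i /(_ i (le_refl i))].
split; first exact: ultimatelyT.
- by move=> P Q; exact: ultimatelyI.
- by move=> P Q PQ; exact: ultimatelyW.
Qed.

(** A generalised Banach limit: an ultrafilter refining the tails converges along every eventually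
    bounded family, because a closed interval is compact. *)
Lemma directed_limit : exists L : (I -> R) -> R,
  [/\ forall u M, ultimately (fun i => `|u i| <= M) -> `|L u| <= M,
      forall u v, ultimately (fun i => u i = v i) -> L u = L v,
      forall k, L (fun=> k) = k,
      forall u v M, ultimately (fun i => `|u i| <= M) ->
        ultimately (fun i => `|v i| <= M) ->
        L (fun i => u i + v i) = L u + L v &
      forall k u M, ultimately (fun i => `|u i| <= M) ->
        L (fun i => k * u i) = k * L u].
Proof.
have [G [GU tG]] := ultraFilterLemma tails_proper.
pose L (u : I -> R) : R := lim (u @ G).
have cvgL u M : ultimately (fun i => `|u i| <= M) -> u @ G --> L u.
  move=> uM.
  have : compact (`[- M, M]%classic : set R) by exact: segment_compact.
  move=> /(_ (u @ G) _) [|l [_ ul]].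
    apply: tG; apply: ultimatelyW uM => i /=.
    by rewrite in_itv /= ler_norml.
  (* A cluster point of an ultrafilter is a limit of it. *)
  apply/cvg_ex; exists l => A lA.
  have [//|GA] := in_ultra_setVsetC (u @^-1` A) GU.
  by have [x [/= nAx Ax]] := ul (~` A) A GA lA.
have Gev (P : I -> Prop) : ultimately P -> \forall i \near G, P i by move/tG.
exists L; split.
- move=> u M uM; have := cvgL _ _ uM.
  move=> /(@cvg_norm _ _ _ _ _ _ _) uL.
  apply: (closed_cvg (fun x : R => x <= M) _ _ _ uL); first exact: closed_le.
  exact: Gev.
- move=> u v uv; rewrite /L; congr (lim _).
  apply/seteqP; split=> A GA.
    by apply: filterS (filterI (Gev _ uv) GA) => i /= [<-].
  by apply: filterS (filterI (Gev _ uv) GA) => i /= [->].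
- by move=> k; apply: cvg_lim => //; exact: cvg_cst.
- move=> u v M uM vM; apply: cvg_lim => //.
  by apply: cvgD; [exact: cvgL uM|exact: cvgL vM].
- move=> k u M uM; apply: cvg_lim => //.
  by apply: cvgMr; exact: cvgL uM.
Qed.

End DirectedLimit.

Section LimitCoboundary.
Variables (R : realType) (I : Type) (le : I -> I -> Prop) (i0 : I).
Hypothesis le_refl : forall i, le i i.
Hypothesis le_trans : forall i j k, le i j -> le j k -> le i k.
Hypothesis le_dir : forall i j, exists k, le i k /\ le j k.

(** Linearity is claimed only for eventually bounded families, where the limit exists. By
    [lim_fun_eq] only tails matter, so an invariance that holds from some index on becomes an exact
    invariance of the limit. *)
Record limit_functional := LimitFunctional {
  lim_fun :> (I -> R) -> R;
  lim_fun_bound : forall u M, ultimately le (fun i => `|u i| <= M) ->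
    `|lim_fun u| <= M;
  lim_fun_eq : forall u v, ultimately le (fun i => u i = v i) ->
    lim_fun u = lim_fun v;
  lim_fun_cst : forall k, lim_fun (fun=> k) = k;
  lim_funD : forall u v M, ultimately le (fun i => `|u i| <= M) ->
    ultimately le (fun i => `|v i| <= M) ->
    lim_fun (fun i => u i + v i) = lim_fun u + lim_fun v;
  lim_funZ : forall k u M, ultimately le (fun i => `|u i| <= M) ->
    lim_fun (fun i => k * u i) = k * lim_fun u }.

Lemma limit_functional_exists : inhabited limit_functional.
Proof.
have [L [? ? ? ? ?]] := directed_limit R le_refl le_trans le_dir i0.
by split; exists L.
Qed.

Lemma lim_funB (L : limit_functional) u v M :
  ultimately le (fun i => `|u i| <= M) ->
  ultimately le (fun i => `|v i| <= M) ->
  L (fun i => u i - v i) = L u - L v.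
Proof.
move=> uM vM; rewrite -mulN1r -(lim_funZ L _ vM) -(lim_funD L uM).
  by congr (L _); apply/funext => i; rewrite mulN1r.
by apply: ultimatelyW vM => i; rewrite mulN1r normrN.
Qed.

Lemma cobd_lim_fun (L : limit_functional) (T : Type) (F : I -> seq T -> R) s M :
  ultimately le (fun i => forall u, del u s -> `|F i u| <= M) ->
  cobd (fun u => L (fun i => F i u)) s = L (fun i => cobd (F i) s).
Proof.
elim: s F => [|x s IH] F FM /=; first by rewrite lim_fun_cst.
have FsM : ultimately le (fun i => `|F i s| <= M).
  by apply: ultimatelyW FM => i; apply; exact: del_head.
have FxM : ultimately le (fun i => forall u, del u s -> `|F i (x :: u)| <= M).
  by apply: ultimatelyW FM => i FiM u us; apply: FiM; exact: del_cons.
rewrite (IH (fun i u => F i (x :: u)) FxM).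
rewrite -(lim_funB L (M := Num.max M ((size s)%:R * M))) //.
  by apply: ultimatelyW FsM => i ?; rewrite le_max; apply/orP; left.
apply: ultimatelyW FxM => i FiM; rewrite le_max; apply/orP; right.
exact: cobd_bound.
Qed.

End LimitCoboundary.

(** * Double complexes *)

Section DoubleComplex.
Variables (R : realType) (J Y X T : Type).
Variables (aY : T -> Y -> Y) (aX : T -> X -> X) (gen : J -> seq Y -> Prop).

Definition hcobd (f : seq Y -> seq X -> R) ys xs := cobd (fun v => f v xs) ys.
Definition vcobd (f : seq Y -> seq X -> R) ys xs := cobd (f ys) xs.

Definition eq_at i p q (f g : seq Y -> seq X -> R) :=
  forall ys xs, gen i ys -> size ys = p -> size xs = q -> f ys xs = g ys xs.

(** Both conditions concern generic [ys] only. The support [i] remains a parameter so that constants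
    can be chosen before it. *)
Record bicochain (tr : J -> T -> Prop) i p q M f : Prop := Bicochain {
  bic_bound : forall ys xs, gen i ys -> size ys = p -> size xs = q ->
    `|f ys xs : R| <= M;
  bic_inv : forall t ys xs, tr i t -> gen i ys -> size ys = p -> size xs = q ->
    f (map (aY t) ys) (map (aX t) xs) = f ys xs }.

Hypothesis gen_del : forall i s u, gen i s -> del u s -> gen i u.

Lemma hcobd_eq i p q f g : eq_at i p.-1 q f g -> eq_at i p q (hcobd f) (hcobd g).
Proof.
move=> fg ys xs gys syp sxq; apply: cobd_ext => u uy; apply: fg => //.
  exact: gen_del uy.
by rewrite -syp (del_size uy).
Qed.

Lemma vcobd_eq i p q f g : eq_at i p q.-1 f g -> eq_at i p q (vcobd f) (vcobd g).
Proof.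
move=> fg ys xs gys syp sxq; apply: cobd_ext => u uy; apply: fg => //.
by rewrite -sxq (del_size uy).
Qed.

Lemma hcobdK f ys xs : hcobd (hcobd f) ys xs = 0.
Proof. exact: cobdK. Qed.

Lemma hvcobdC f ys xs : hcobd (vcobd f) ys xs = vcobd (hcobd f) ys xs.
Proof. exact: cobdC. Qed.

Section Invariance.
Variable tr : J -> T -> Prop.

Lemma bic_le i p q M M' f : M <= M' ->
  bicochain tr i p q M f -> bicochain tr i p q M' f.
Proof. by move=> MM' [fM finv]; split=> // ys xs ? ? ?; rewrite (le_trans _ MM') ?fM. Qed.

Lemma bic0 i p q M : 0 <= M -> bicochain tr i p q M (fun _ _ => 0).
Proof. by move=> M0; split=> // *; rewrite normr0. Qed.

Lemma bicD i p q M M' f g :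
  bicochain tr i p q M f -> bicochain tr i p q M' g ->
  bicochain tr i p q (M + M') (fun ys xs => f ys xs + g ys xs).
Proof.
move=> [fM finv] [gM ginv]; split=> [ys xs ? ? ?|t ys xs ? ? ? ?].
  by rewrite (le_trans (ler_normD _ _)) // lerD ?fM ?gM.
by rewrite finv ?ginv.
Qed.

Lemma bicB i p q M M' f g :
  bicochain tr i p q M f -> bicochain tr i p q M' g ->
  bicochain tr i p q (M + M') (fun ys xs => f ys xs - g ys xs).
Proof.
move=> [fM finv] [gM ginv]; split=> [ys xs ? ? ?|t ys xs ? ? ? ?].
  by rewrite (le_trans (ler_normB _ _)) // lerD ?fM ?gM.
by rewrite finv ?ginv.
Qed.

Lemma bic_hcobd i p q M f : bicochain tr i p q M f ->
  bicochain tr i p.+1 q (p.+1%:R * M) (hcobd f).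
Proof.
move=> [fM finv]; split=> [ys xs gy sy sx|t ys xs tt gy sy sx]; rewrite /hcobd.
  rewrite -sy; apply: cobd_bound => u uy; apply: fM => //.
    exact: gen_del uy.
  by apply: succn_inj; rewrite -(del_size uy).
rewrite cobd_map; apply: cobd_ext => u uy; apply: finv => //.
  exact: gen_del uy.
by apply: succn_inj; rewrite -(del_size uy).
Qed.

Lemma bic_vcobd i p q M f : bicochain tr i p q M f ->
  bicochain tr i p q.+1 (q.+1%:R * M) (vcobd f).
Proof.
move=> [fM finv]; split=> [ys xs gy sy sx|t ys xs tt gy sy sx]; rewrite /vcobd.
  rewrite -sx; apply: cobd_bound => u ux; apply: fM => //.
  by apply: succn_inj; rewrite -(del_size ux).
rewrite cobd_map; apply: cobd_ext => u ux; apply: finv => //.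
by apply: succn_inj; rewrite -(del_size ux).
Qed.

Variable good : J -> nat -> nat -> R -> (seq Y -> seq X -> R) -> Prop.
Hypothesis good_le : forall i p q M M' f, M <= M' ->
  good i p q M f -> good i p q M' f.

Definition zero2 : seq Y -> seq X -> R := fun _ _ => 0.

Hypothesis row_exact : forall p q M, exists M', forall i r,
  bicochain tr i p q.+1 M r -> eq_at i p.+1 q.+1 (hcobd r) zero2 ->
  exists2 e, bicochain tr i p.-1 q.+1 M' e & eq_at i p q.+1 r (hcobd e).
Hypothesis row0_exact : forall p M, exists M', forall i r,
  bicochain tr i p 0 M r -> good i p 0 M r -> eq_at i p.+1 0 (hcobd r) zero2 ->
  exists2 e, bicochain tr i p.-1 0 M' e & eq_at i p 0 r (hcobd e).
Variable n : nat.
Hypothesis col_exact : forall p q M, (q < n)%N -> exists M', forall i f,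
  bicochain tr i p.+1 q M f -> eq_at i p.+1 q.+1 (vcobd f) zero2 ->
  exists2 b, bicochain tr i p.+1 q.-1 M' b & eq_at i p.+1 q f (vcobd b).
Hypothesis good_step : forall p q M, exists M', forall i r s,
  bicochain tr i p q.+1 M r -> good i p q.+1 M r -> bicochain tr i p.+1 q M s ->
  eq_at i p.+1 q.+1 (hcobd r) (vcobd s) -> good i p.+1 q M' s.

(** As [hcobd s] is a vertical cocycle, column exactness writes it as [vcobd s'], and [(s, s')] is
    the same problem with [q] smaller. Its solution [s = hcobd e' + vcobd f'] makes [r - vcobd e']
    horizontally closed, and row exactness concludes. The predicate [good] travels along because row
    0 is exact on good elements only. At [q = 0] the truncation [q.-1] is harmless: [cobd] vanishes
    on the empty list. *)
Lemma zigzag q p M : (q <= n)%N -> exists M', forall i r s,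
  bicochain tr i p q M r -> good i p q M r -> bicochain tr i p.+1 q.-1 M s ->
  eq_at i p.+1 q (hcobd r) (vcobd s) ->
  exists e f, [/\ bicochain tr i p.-1 q M' e, bicochain tr i p q.-1 M' f &
    eq_at i p q r (fun ys xs => hcobd e ys xs + vcobd f ys xs)].
Proof.
elim: q p M => [|q IH] p M qn.
  have [M' rowE] := row0_exact p M.
  exists (Num.max M' 0) => i r s rA rG sA rs.
  have [|e eA eE] := rowE i r rA rG.
    move=> ys xs gy sy sx; rewrite rs //.
    by rewrite /vcobd (size0nil sx).
  exists e, zero2; split.
  - by apply: bic_le eA; rewrite le_max lexx.
  - by apply: bic0; rewrite le_max lexx orbT.
  - move=> ys xs gy sy sx; rewrite eE // /vcobd (size0nil sx) /=.
    by rewrite addr0.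
have [M1 goodS] := good_step p q M.
have [M2 col] := col_exact p.+1 (p.+2%:R * M) qn.
have [M3 {}IH] := IH p.+1 (Num.max M (Num.max M1 M2)) (ltnW qn).
have [M4 row] := row_exact p q (M + q.+1%:R * M3).
exists (Num.max M3 M4) => i r s rA rG sA rs.
have [|s' s'A s'E] := col i (hcobd s) (bic_hcobd sA).
  move=> ys xs gy sy sx; rewrite -hvcobdC.
  rewrite (@hcobd_eq i p.+2 q.+1 (vcobd s) (hcobd r)) ?hcobdK //.
  by move=> *; rewrite rs.
have [|||e' [f' [e'A f'A e'f']]] := IH i s s' _ _ _ s'E.
- by apply: bic_le sA; rewrite le_max lexx.
- by apply: good_le (goodS _ _ _ rA rG sA rs); rewrite !le_max lexx orbT.
- by apply: bic_le s'A; rewrite !le_max lexx !orbT.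
have [|e eA eE] := row i _ (bicB rA (bic_vcobd e'A)).
  move=> ys xs gy sy sx; rewrite /hcobd cobdB.
  rewrite [X in X - _]rs // [X in _ - X]hvcobdC.
  rewrite (vcobd_eq (g := fun ys xs => hcobd e' ys xs + vcobd f' ys xs) _ gy sy sx) //.
  by rewrite /vcobd cobdD [X in _ + X - _]cobdK addr0 subrr.
exists e, e'; split.
- by apply: bic_le eA; rewrite !le_max lexx !orbT.
- by apply: bic_le e'A; rewrite !le_max lexx.
- by move=> ys xs gy sy sx; rewrite -eE // subrK.
Qed.

End Invariance.

End DoubleComplex.
(** * Cochains invariant under rigid stabilisers *)

Lemma del_subseq (T : eqType) (u s : seq T) : del u s -> subseq u s.
Proof.
by elim=> [x {}s|x {}u {}s _ us]; [exact: subseq_cons|rewrite /= eqxx].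
Qed.

Section EquivariantRetraction.
Variables (H : groupType) (P : H -> Prop).
Hypothesis P1 : P 1%g.
Hypothesis PM : forall g h, P g -> P h -> P (g * h)%g.
Hypothesis PV : forall g, P g -> P g^-1%g.

(** With a representative [r g] of each coset [P g], the map sending [g] to [g (r g)^-1] is
    equivariant. It pulls cochains on the subgroup back to invariant cochains on the whole group. *)
Lemma equivariant_retraction : exists pi : H -> H,
  [/\ forall g, P (pi g), forall h g, P h -> pi (h * g)%g = (h * pi g)%g &
      forall h, P h -> pi h = h].
Proof.
(* Representing the subgroup itself by 1 makes [pi] the identity on it. *)
pose r g := if `[< P g >] then 1%g else xget 1%g [set g' | P (g * g'^-1)%g].
have rP g : P (g * (r g)^-1)%g.
  rewrite /r; case: asboolP => [|_]; first by rewrite invg1 mulg1.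
  by case: xgetP => [_ -> //|/(_ g)]; rewrite /= mulgV.
have rM h g : P h -> r (h * g)%g = r g.
  move=> Ph; have Phg x : P (h * x)%g = P x.
    apply/propext; split=> [Phx|]; last exact: PM.
    by rewrite -(mulKg h x); apply: PM => //; exact: PV.
  rewrite /r Phg; case: asboolP => // _; congr xget.
  by apply/funext => x; rewrite /mkset -mulgA Phg.
exists (fun g => g * (r g)^-1)%g; split=> // [h g Ph|h Ph].
  by rewrite rM // mulgA.
by rewrite /r asboolT // invg1 mulg1.
Qed.

End EquivariantRetraction.

Section RigidStabilisers.
Variables (R : realType) (H : groupType) (X : eqType) (a : group_action H X).
Implicit Types (U V W A B : set X) (g h k l : H).

Definition supp U g := forall x, ~ U x -> a g x = x.

Lemma actVK g x : a g^-1%g (a g x) = x.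
Proof. by rewrite -actM mulVg act1. Qed.

Lemma actKV g x : a g (a g^-1%g x) = x.
Proof. by rewrite -actM mulgV act1. Qed.

Lemma supp1 U : supp U 1%g.
Proof. by move=> x _; rewrite act1. Qed.

Lemma suppM U g h : supp U g -> supp U h -> supp U (g * h)%g.
Proof. by move=> gU hU x Ux; rewrite actM hU ?gU. Qed.

Lemma suppV U g : supp U g -> supp U g^-1%g.
Proof. by move=> gU x Ux; rewrite -{1}(gU x Ux) actVK. Qed.

Lemma suppW U V g : U `<=` V -> supp U g -> supp V g.
Proof. by move=> UV gU x Vx; apply: gU => /UV. Qed.

Lemma supp_stable U g x : supp U g -> U x -> U (a g x).
Proof.
move=> gU Ux; apply: contrapT => Ugx; apply: (Ugx).
by rewrite (can_inj (actVK g) (gU _ Ugx)).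
Qed.

Lemma supp_conj U V t g : (forall x, U x -> V (a t x)) -> supp U g ->
  supp V (t * g * t^-1)%g.
Proof.
move=> UV gU x Vx; rewrite !actM gU ?actKV // => /UV.
by rewrite actKV.
Qed.

Hypothesis faithful : faithful_action a.

Lemma act_inj g h : (forall x, a g x = a h x) -> g = h.
Proof.
move=> gh; apply: (mulIg h^-1%g); rewrite mulgV; apply: faithful => x.
by rewrite actM gh actKV.
Qed.

Lemma supp_disjoint A B g : A `&` B = set0 -> supp A g -> supp B g -> g = 1%g.
Proof.
move=> AB gA gB; apply: faithful => x.
have [Ax|] := pselect (A x); last exact: gA.
by apply: gB => Bx; have : (A `&` B) x by []; rewrite AB.
Qed.

Lemma supp_comm A B g h : A `&` B = set0 -> supp A g -> supp B h ->
  (g * h = h * g)%g.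
Proof.
move=> AB gA hB; apply: act_inj => x; rewrite !actM.
have nAB y : A y -> ~ B y.
  by move=> Ay By; have : (A `&` B) y by []; rewrite AB.
have [Ax|nAx] := pselect (A x).
  by rewrite hB ?hB //; apply: nAB => //; exact: supp_stable.
rewrite (gA _ nAx) gA //.
have [Bx|nBx] := pselect (B x); last by rewrite hB.
by move=> /nAB; apply; exact: supp_stable.
Qed.

Definition joint A B h := exists k l, [/\ supp A k, supp B l & h = (k * l)%g].

(** A retraction onto the product of the two groups, split into its factors. The splitting is unique
    because an element supported in both [A] and [B] is trivial by faithfulness. *)
Lemma joint_retraction A B : A `&` B = set0 -> exists kappa lambda : H -> H,
  [/\ forall g, supp A (kappa g), forall g, supp B (lambda g),
      forall k l g, supp A k -> supp B l ->
        kappa (k * l * g)%g = (k * kappa g)%g /\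
        lambda (k * l * g)%g = (l * lambda g)%g &
      forall k l, supp A k -> supp B l ->
        kappa (k * l)%g = k /\ lambda (k * l)%g = l].
Proof.
move=> AB; have [|||pi [piP piM piK]] := @equivariant_retraction H (joint A B).
- by exists 1%g, 1%g; split; [exact: supp1|exact: supp1|rewrite mulg1].
- move=> _ _ [k [l [kA lB ->]]] [k' [l' [kA' lB' ->]]].
  exists (k * k')%g, (l * l')%g; split; [exact: suppM|exact: suppM|].
  by rewrite -!mulgA; congr (_ * _)%g; rewrite !mulgA -(supp_comm AB kA' lB).
- move=> _ [k [l [kA lB ->]]]; exists k^-1%g, l^-1%g.
  split; [exact: suppV|exact: suppV|rewrite invgM].
  by rewrite (supp_comm AB (suppV kA) (suppV lB)).
have dec g : exists kl, [/\ supp A kl.1, supp B kl.2 & pi g = (kl.1 * kl.2)%g].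
  by have [k [l [? ? ?]]] := piP g; exists (k, l).
pose d g := projT1 (cid (dec g)).
have dA g : supp A (d g).1 by rewrite /d; case: cid => ? [].
have dB g : supp B (d g).2 by rewrite /d; case: cid => ? [].
have dE g : pi g = ((d g).1 * (d g).2)%g by rewrite /d; case: cid => ? [].
have uniq k l k' l' : supp A k -> supp B l -> supp A k' -> supp B l' ->
    (k * l = k' * l')%g -> k = k' /\ l = l'.
  move=> kA lB kA' lB' E.
  have E' : (k'^-1 * k = l' * l^-1)%g.
    by apply: (mulgI k'); rewrite mulVKg mulgA -E mulgK.
  have k1 : (k'^-1 * k)%g = 1%g.
    apply: (supp_disjoint AB); first by apply: suppM => //; exact: suppV.
    by rewrite E'; apply: suppM => //; exact: suppV.
  have kk' : k = k' by rewrite -(mulVKg k' k) k1 mulg1.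
  by split=> //; move: E; rewrite kk' => /mulgI.
exists (fun g => (d g).1), (fun g => (d g).2); split=> // [k l g kA lB|k l kA lB].
  apply: uniq; try by [|exact: suppM].
  rewrite -dE piM ?dE; last by exists k, l.
  by rewrite -!mulgA; congr (_ * _)%g; rewrite !mulgA (supp_comm AB (dA g) lB).
by apply: uniq => //; rewrite -dE piK //; exists k, l.
Qed.

(** Cochains of the subgroup [P] live on tuples of the ambient group, on which [P] acts freely. One
    complex thus serves all supports, and restriction to a subgroup forgets part of the
    invariance. *)
Record inv_cochain (P : H -> Prop) q (M : R) (f : seq H -> R) : Prop := InvCochain {
  invc_bound : forall s, size s = q -> `|f s| <= M;
  invc_inv : forall h s, P h -> size s = q -> f (map (fun g => h * g)%g s) = f s }.

Definition cocycle q (f : seq H -> R) := forall s, size s = q.+1 -> cobd f s = 0.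

Lemma invc_le (P : H -> Prop) q M M' f : M <= M' ->
  inv_cochain P q M f -> inv_cochain P q M' f.
Proof. by move=> MM' [fM fP]; split=> // s sq; rewrite (le_trans (fM s sq)). Qed.

Lemma invcW (P Q : H -> Prop) q M f : (forall h, Q h -> P h) ->
  inv_cochain P q M f -> inv_cochain Q q M f.
Proof. by move=> PQ [fM fP]; split=> // h s Qh; apply: fP; exact: PQ. Qed.

Lemma cocycle_cone q f g s : cocycle q f -> size s = q ->
  f s = cobd (fun u => f (g :: u)) s.
Proof. by move=> fc sq; rewrite {1}(cobd_cone f g) fc ?addr0 //= sq. Qed.

Variable clopn : set X -> Prop.

(* The quantifiers make the bound on the primitive uniform in [U], which is
   what lets primitives be glued along an increasing family of supports. *)
Definition uniformly_acyclic q := forall M, exists M', forall U f, clopn U ->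
  inv_cochain (supp U) q M f -> cocycle q f ->
  exists2 b, inv_cochain (supp U) q.-1 M' b &
    forall s, size s = q -> f s = cobd b s.

(** * The double complex of two commuting rigid stabilisers *)

Section Kunneth.
Variable n : nat.
Hypothesis acyc : forall q, (q < n.+1)%N -> uniformly_acyclic q.

Let J := {AB : set X * set X | clopn AB.2 /\ AB.1 `&` AB.2 = set0}.
(** The pair acts on [ys] through its first factor only and on [xs] through the product, so [ys]
    resolves the first factor and [xs] resolves both. *)
Let aY (t : H * H) y := (t.1 * y)%g.
Let aX (t : H * H) x := (t.1 * t.2 * x)%g.
Let gen (i : J) (ys : seq H) := forall y, y \in ys -> supp (proj1_sig i).1 y.
Let tr (i : J) (t : H * H) := supp (proj1_sig i).1 t.1 /\ supp (proj1_sig i).2 t.2.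
Let trA (i : J) (t : H * H) := supp (proj1_sig i).1 t.1 /\ t.2 = 1%g.

Lemma kunneth_gen_del i s u : gen i s -> del u s -> gen i u.
Proof. by move=> gs us y yu; apply: gs; exact: (mem_subseq (del_subseq us)). Qed.

Lemma kunneth_trW i t : trA i t -> tr i t.
Proof. by case: t => k l [/= ? ->]; split=> //=; exact: supp1. Qed.

(* Row 0 computes the cohomology of the first factor, about which nothing is
   known; [good] records that an element restricts trivially to that factor. *)
Let good i p q (M : R) (r : seq H -> seq H -> R) := exists b c, [/\
  bicochain aY aX gen trA i p.-1 q M b,
  bicochain aY aX gen trA i p q.-1 M c &
  eq_at gen i p q r (fun ys xs => hcobd b ys xs + vcobd c ys xs)].

Lemma kunneth_good_le i p q M M' f : M <= M' -> good i p q M f -> good i p q M' f.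
Proof.
move=> MM' [b [c [bM cM bc]]].
by exists b, c; split=> //; [exact: bic_le bM|exact: bic_le cM].
Qed.

(** The row is coned with the first factor of the retraction of the head of [xs], an equivariant
    vertex, available since [xs] is nonempty. *)
Lemma kunneth_row p q (M : R) : exists M', forall i r,
  bicochain aY aX gen tr i p q.+1 M r ->
  eq_at gen i p.+1 q.+1 (hcobd r) (@zero2 R H H) ->
  exists2 e, bicochain aY aX gen tr i p.-1 q.+1 M' e & eq_at gen i p q.+1 r (hcobd e).
Proof.
exists (Num.max M 0) => i r [rM rI] r0.
have [ka [la [kaP _ kaM _]]] := joint_retraction (proj2 (proj2_sig i)).
case: p rM rI r0 => [|p] rM rI r0 /=.
  exists (@zero2 R H H); first by apply: bic0; rewrite le_max lexx orbT.
  move=> ys xs gy sy sx; rewrite (size0nil sy) /hcobd /=.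
  have := r0 [:: 1%g] xs _ erefl sx; rewrite /hcobd /zero2 /= subr0; apply.
  by move=> y; rewrite inE => /eqP ->; exact: supp1.
have gcons xs ys : gen i ys -> gen i (ka (head 1%g xs) :: ys).
  by move=> gy y; rewrite inE => /predU1P[->|/gy].
exists (fun ys xs => r (ka (head 1%g xs) :: ys) xs).
  split=> [ys xs gy sy sx|t ys xs [tA tB] gy sy sx].
    by rewrite le_max rM //=; [exact: gcons|rewrite sy].
  case: xs sx => //= x xs sx; rewrite (kaM _ _ _ tA tB).1.
  by apply: (rI t (ka x :: ys) (x :: xs)) => //=; [exact: (gcons (x :: xs))|rewrite sy].
move=> ys xs gy sy sx.
rewrite (cobd_cone (fun v => r v xs) (ka (head 1%g xs)) ys).
have -> : cobd (fun v => r v xs) (ka (head 1%g xs) :: ys) = 0.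
  by apply: (r0 (_ :: ys) xs (gcons xs ys gy) _ sx); rewrite /= sy.
by rewrite addr0.
Qed.

(** With [xs] empty the second factor acts trivially, so invariance of [b] under the first factor is
    already full invariance, and the vertical part of [good] vanishes. *)
Lemma kunneth_row0 p (M : R) : exists M', forall i r,
  bicochain aY aX gen tr i p 0 M r -> good i p 0 M r ->
  eq_at gen i p.+1 0 (hcobd r) (@zero2 R H H) ->
  exists2 e, bicochain aY aX gen tr i p.-1 0 M' e & eq_at gen i p 0 r (hcobd e).
Proof.
exists M => i r _ [b [c [[bM bI] _ rE]]] _; exists b.
  split=> // t ys xs [tA tB] gy sy /size0nil ->.
  exact: (bI (t.1, 1%g) ys [::]).
move=> ys xs gy sy sx; rewrite rE // /vcobd (size0nil sx) /=.
by rewrite addr0.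
Qed.

Lemma kunneth_col p q (M : R) : (q < n.+1)%N -> exists M', forall i f,
  bicochain aY aX gen tr i p.+1 q M f ->
  eq_at gen i p.+1 q.+1 (vcobd f) (@zero2 R H H) ->
  exists2 b, bicochain aY aX gen tr i p.+1 q.-1 M' b &
    eq_at gen i p.+1 q f (vcobd b).
Proof.
move=> /acyc/(_ M)[M' acycM]; exists M' => i f [fM fI] f0.
have [clB AB] := proj2_sig i.
have prim ys : exists b : seq H -> R, gen i ys -> size ys = p.+1 ->
    inv_cochain (supp (proj1_sig i).2) q.-1 M' b /\
    forall s, size s = q -> f ys s = cobd b s.
  have [[gy sy]|nys] := pselect (gen i ys /\ size ys = p.+1); last first.
    by exists (fun=> 0) => gy sy; case: nys.
  have [|s sq|b bI bE] := acycM (proj1_sig i).2 (f ys) clB; last by exists b.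
    split=> [s sq|h s hB sq]; first exact: fM.
    have /= := fI (1%g, h) ys s (conj (@supp1 _) hB) gy sy sq.
    by rewrite /aY /aX mul1g (eq_map (@mul1g H)) map_id.
  exact: f0.
pose be ys := projT1 (cid (prim ys)).
have beI ys : gen i ys -> size ys = p.+1 ->
    inv_cochain (supp (proj1_sig i).2) q.-1 M' (be ys).
  by rewrite /be; case: cid => b /= bP gy sy; case: (bP gy sy).
have beE ys s : gen i ys -> size ys = p.+1 -> size s = q ->
    f ys s = cobd (be ys) s.
  by rewrite /be; case: cid => b /= bP gy sy sq; case: (bP gy sy) => _; apply.
(* The first factor acts freely on [ys]: primitives are chosen only for tuples with first entry 1
   and transported to the others, which makes the choice equivariant. *)
pose shift (k : H) s := map (fun g => k^-1 * g)%g s.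
have gshift ys : gen i ys -> gen i (shift (head 1%g ys) ys).
  move=> gy z /mapP[y yy ->]; apply: suppM; last exact: gy.
  apply: suppV; case: ys gy yy => [|y' ys] gy _ /=; first exact: supp1.
  by apply: gy; rewrite inE eqxx.
exists (fun ys xs => be (shift (head 1%g ys) ys) (shift (head 1%g ys) xs)).
  split=> [ys xs gy sy sx|t ys xs [tA tB] gy sy sx].
    apply: (invc_bound (beI _ (gshift _ gy) _)); by rewrite size_map.
  case: ys gy sy => // y ys gy sy.
  have -> : shift (head 1%g (map (aY t) (y :: ys))) (map (aY t) (y :: ys)) =
      shift y (y :: ys).
    rewrite /shift -map_comp; apply: eq_map => z /=.
    by rewrite /aY invgM -!mulgA mulKg.
  have -> : shift (head 1%g (map (aY t) (y :: ys))) (map (aX t) xs) =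
      map (fun g => t.2 * g)%g (shift y xs).
    rewrite /shift -!map_comp; apply: eq_map => z /=.
    have yA : supp (proj1_sig i).1 y^-1%g by apply/suppV/gy; rewrite inE eqxx.
    rewrite /aY /aX invgM !mulgA; congr (_ * _)%g.
    by rewrite mulgVK (supp_comm AB yA tB).
  apply: (invc_inv (beI _ (gshift _ gy) _)) => //; by rewrite size_map.
move=> ys xs gy sy sx; case: ys gy sy => // y ys gy sy.
have yA : supp (proj1_sig i).1 y^-1%g by apply/suppV/gy; rewrite inE eqxx.
rewrite /vcobd -cobd_map -beE /= ?size_map //; last exact: (gshift (y :: ys)).
have /= := fI (y^-1%g, 1%g) (y :: ys) xs (conj yA (@supp1 _)) gy sy sx.
rewrite /aY /aX /= => <-; congr (f _ _).
by apply: eq_map => z; rewrite mulg1.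
Qed.

(** The difference [s - hcobd c] is a vertical cocycle. Under the first factor alone, the head of
    [ys] is an equivariant cone vertex, so columns contract in every degree without induction. *)
Lemma kunneth_good p q (M : R) : exists M', forall i r s,
  bicochain aY aX gen tr i p q.+1 M r -> good i p q.+1 M r ->
  bicochain aY aX gen tr i p.+1 q M s ->
  eq_at gen i p.+1 q.+1 (hcobd r) (vcobd s) -> good i p.+1 q M' s.
Proof.
exists (Num.max M (Num.max 0 (M + p.+1%:R * M))).
move=> i r s _ [b [c [_ cA rE]]] sA rs.
pose d ys xs := s ys xs - hcobd c ys xs.
have dA : bicochain aY aX gen trA i p.+1 q (M + p.+1%:R * M) d.
  apply: bicB; last exact: (bic_hcobd kunneth_gen_del cA).
  by case: sA => sM sI; split=> // t ys xs /kunneth_trW; exact: sI.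
have d0 : eq_at gen i p.+1 q.+1 (vcobd d) (@zero2 R H H).
  move=> ys xs gy sy sx; rewrite /vcobd cobdB -[X in X - _](rs ys xs) //.
  rewrite [X in X - _](hcobd_eq kunneth_gen_del (p := p.+1) rE gy sy sx) /hcobd cobdD.
  by rewrite [X in X + _ - _]cobdK add0r [X in X - _]cobdC subrr.
exists c; case: q => [|q] in dA d0 cA rE sA rs *.
  exists (@zero2 R H H); split.
  - by apply: bic_le cA; rewrite le_max lexx.
  - by apply: bic0; rewrite !le_max lexx orbT.
  - move=> ys xs gy sy sx; rewrite (size0nil sx) /vcobd /= addr0.
    apply/eqP; rewrite -subr_eq0; apply/eqP.
    have := d0 ys [:: 1%g] gy sy erefl; by rewrite /vcobd /zero2 /= subr0.
exists (fun ys xs => d ys (head 1%g ys :: xs)); split.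
- by apply: bic_le cA; rewrite le_max lexx.
- case: dA => dM dI; split=> [ys xs gy sy sx|t ys xs tt gy sy sx].
    by rewrite !le_max dM ?orbT //= sx.
  case: ys gy sy => // y ys gy sy /=.
  rewrite -(dI t (y :: ys) (y :: xs)) //= ?sx //.
  by case: tt => _; rewrite /aX /aY => ->; rewrite mulg1.
- move=> ys xs gy sy sx; apply/eqP; rewrite addrC -subr_eq; apply/eqP.
  rewrite -[LHS]/(d ys xs) (cobd_cone (d ys) (head 1%g ys) xs).
  have -> : cobd (d ys) (head 1%g ys :: xs) = 0.
    by apply: (d0 ys (_ :: xs)); rewrite //= sx.
  by rewrite addr0.
Qed.

(** In column 0 the primitive on [A] makes [u] good, while the primitive on [B], translated by the
    head of [ys], starts the zigzag. Its outcome at empty [ys] is a primitive on the product. *)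
Lemma kunneth (M : R) : exists M', forall A B u bA bB, clopn B -> A `&` B = set0 ->
  inv_cochain (joint A B) n.+1 M u ->
  inv_cochain (supp A) n M bA -> inv_cochain (supp B) n M bB ->
  (forall s, size s = n.+1 -> u s = cobd bA s) ->
  (forall s, size s = n.+1 -> u s = cobd bB s) ->
  exists2 b, inv_cochain (joint A B) n M' b &
    forall s, size s = n.+1 -> u s = cobd b s.
Proof.
have [M' zz] := zigzag kunneth_gen_del kunneth_good_le kunneth_row kunneth_row0
  kunneth_col kunneth_good 0 (Num.max M 0) (leqnn n.+1).
exists M' => A B u bA bB clB AB [uM uI] [bAM bAI] [bBM bBI] uA uB.
pose i : J := exist _ (A, B) (conj clB AB).
have MM : M <= Num.max M 0 by rewrite le_max lexx.
have M0 : 0 <= Num.max M 0 by rewrite le_max lexx orbT.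
have uA1 y s : supp A y -> size s = n.+1 -> u (map (fun g => y * g)%g s) = u s.
  move=> yA; apply: uI; exists y, 1%g; split=> //; first exact: supp1.
  by rewrite mulg1.
have uE : good i 0 n.+1 (Num.max M 0) (fun _ => u).
  exists (@zero2 R H H), (fun _ => bA); split; first exact: bic0.
    split=> [ys xs _ _ sx|[k l] ys xs [/= kA ->] _ _ sx].
      exact: le_trans (bAM _ sx) MM.
    by rewrite /aX /= mulg1; exact: bAI.
  by move=> ys xs gy /size0nil -> sx; rewrite /hcobd /= add0r; exact: uA.
pose s ys xs := bB (map (fun g => (head 1 ys)^-1 * g)%g xs).
have [|||e [f [_ [fM fI] uef]]] := zz i (fun _ => u) s _ uE.
- split=> [ys xs _ _ sx|[k l] ys xs [/= kA lB] _ _ sx].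
    exact: le_trans (uM _ sx) MM.
  by apply: uI => //; exists k, l.
- split=> [ys xs _ _ sx|[k l] ys xs [/= kA lB] gy sy sx].
    by apply: le_trans MM; apply: bBM; rewrite size_map.
  case: ys gy sy => // y ys gy sy; rewrite /s.
  rewrite -(bBI l (map _ xs)) //= ?size_map //.
  congr bB; rewrite -!map_comp; apply: eq_map => z /=.
  have yA : supp A y^-1%g by apply/suppV/gy; rewrite inE eqxx.
  by rewrite /aX /aY /= invgM !mulgA mulgVK (supp_comm AB yA lB).
- move=> ys xs; case: ys => // y [|//] gy _ sx.
  rewrite /hcobd /vcobd /s /= subr0 -cobd_map -uB ?size_map // uA1 //.
  by apply/suppV/gy; rewrite inE eqxx.
exists (f [::]).
  split=> [xs sx|_ xs [k [l [kA lB ->]]] sx]; first exact: (fM [::]).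
  exact: (fI (k, l) [::]).
by move=> xs sx; rewrite (uef [::]) // /hcobd add0r.
Qed.
End Kunneth.

(* On [joint A B] a cocycle minus its two pullbacks becomes trivial on each
   factor, so the Kunneth argument applies to the difference. *)
Lemma cocycle_additive n (M : R) :
  (forall q, (q < n.+1)%N -> uniformly_acyclic q) ->
  exists M', forall U A B c ka la, clopn B -> A `&` B = set0 ->
  A `<=` U -> B `<=` U ->
  (forall g, supp A (ka g)) -> (forall g, supp B (la g)) ->
  (forall k l g, supp A k -> supp B l -> ka (k * l * g)%g = (k * ka g)%g /\
     la (k * l * g)%g = (l * la g)%g) ->
  inv_cochain (supp U) n.+1 M c -> cocycle n.+1 c ->
  exists2 b, inv_cochain (joint A B) n M' b & forall s, size s = n.+1 ->
    c s - c (map ka s) - c (map la s) = cobd b s.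
Proof.
move=> acyc; have [M' kun] := kunneth acyc (Num.max (M + M + M) (n%:R * M + M)).
exists M' => U A B c ka la clB AB AU BU kaA laB kaM cI cc.
have M0 : 0 <= M.
  by apply: le_trans (invc_bound cI (s := nseq n.+1 1%g) _); rewrite ?size_nseq.
(* On one factor, the equivariant coordinate [f] is homotopic to the identity through a prism, and
   the pullback along the invariant coordinate [g] bounds the cone with the constant vertex 1. *)
have kala1 D (f g : H -> H) : D `<=` U -> (forall x, supp D (f x)) ->
    (forall h x, supp D h -> f (h * x)%g = (h * f x)%g) ->
    (forall h x, supp D h -> g (h * x)%g = g x) ->
    exists2 b, inv_cochain (supp D) n (Num.max (M + M + M) (n%:R * M + M)) b &
      forall s, size s = n.+1 -> c s - c (map f s) - c (map g s) = cobd b s.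
  move=> DU fD fM gM; case: cI => cM cI.
  exists (fun s => prism f id c s - c (1%g :: map g s)).
    split=> [s sn|h s hD sn].
      rewrite le_max; apply/orP; right; rewrite (le_trans (ler_normB _ _)) //.
      apply: lerD; last by apply: cM; rewrite /= size_map sn.
      by rewrite -sn; apply: prism_bound => u; rewrite sn; exact: cM.
    rewrite -map_comp (eq_map (g := g)); last by move=> x /=; exact: gM.
    congr (_ - _); rewrite (@prism_map _ _ _ _ _ _ _ _ (fun x => h * x)%g) //.
      by apply: prism_ext => u; rewrite sn; apply: cI; exact: suppW hD.
    by move=> x; exact: fM.
  move=> s sn; rewrite cobdB -(prism_homotopy f id cc sn) map_id.
  congr (_ - _); rewrite (cocycle_cone 1%g cc) ?size_map //.
  by rewrite cobd_map.
have kaA1 h g : supp A h -> ka (h * g)%g = (h * ka g)%g /\ la (h * g)%g = la g.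
  move=> hA; have := kaM h 1%g g hA (@supp1 _).
  by rewrite mulg1 mul1g.
have laB1 h g : supp B h -> la (h * g)%g = (h * la g)%g /\ ka (h * g)%g = ka g.
  move=> hB; have := kaM 1%g h g (@supp1 _) hB.
  by rewrite !mul1g => -[].
have [bA bAI bAE] := kala1 A ka la AU kaA
  (fun h x hA => (kaA1 h x hA).1) (fun h x hA => (kaA1 h x hA).2).
have [bB bBI bBE] := kala1 B la ka BU laB
  (fun h x hA => (laB1 h x hA).1) (fun h x hA => (laB1 h x hA).2).
apply: (kun A B (fun s => c s - c (map ka s) - c (map la s)) bA bB) => //.
  case: cI => cM cI; split=> [s sn|_ s [k [l [kA lB ->]]] sn].
    rewrite le_max; apply/orP; left.
    rewrite (le_trans (ler_normB _ _)) // lerD ?cM ?size_map //.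
    by rewrite (le_trans (ler_normB _ _)) // lerD ?cM ?size_map.
  congr (_ - _ - _).
  - by apply: cI => //; apply: suppM; [exact: suppW kA|exact: suppW lB].
  - rewrite -(cI k (map ka s)) ?size_map //; last exact: suppW kA.
    by rewrite -!map_comp; congr c; apply: eq_map => x /=; rewrite (kaM _ _ _ kA lB).1.
  - rewrite -(cI l (map la s)) ?size_map //; last exact: suppW lB.
    by rewrite -!map_comp; congr c; apply: eq_map => x /=; rewrite (kaM _ _ _ kA lB).2.
by move=> s sn; rewrite -bBE // -!addrA; congr (_ + _); rewrite addrC.
Qed.

(** * Displacement of clopen sets, germs, and transitivity on frames *)

Implicit Types gs ks : seq H.
Hypothesis clopnC : forall A, clopn A -> clopn (~` A).
Hypothesis clopnI : forall A B, clopn A -> clopn B -> clopn (A `&` B).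
Hypothesis clopn0 : clopn set0.
Hypothesis clopn_act : forall g A, clopn A -> clopn [set x | A (a g x)].
Hypothesis clopn_sep : forall x y, x != y ->
  exists D, [/\ clopn D, D x & ~ D y].
Variable x0 : X.
Hypothesis orbit_infinite : forall U (l : seq X), clopn U -> U !=set0 ->
  exists g, U (a g x0) /\ a g x0 \notin l.
Hypothesis swap : forall A g, clopn A -> (forall x, A x -> ~ A (a g x)) ->
  exists t, [/\ forall x, A x -> a t x = a g x,
    forall x, A x -> a t (a g x) = x &
    forall x, ~ A x -> ~ A (a g^-1%g x) -> a t x = x].
Hypothesis compress : forall V W, clopn V -> clopn W -> W !=set0 ->
  V `&` W = set0 ->
  exists t, (forall x, V x -> W (a t x)) /\ supp (V `|` W) t.

Lemma clopnU A B : clopn A -> clopn B -> clopn (A `|` B).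
Proof.
by move=> cA cB; rewrite -[_ `|` _]setCK setCU; apply/clopnC/clopnI; exact: clopnC.
Qed.

Lemma clopn_sep_seq (k l : seq X) : (forall x, x \in k -> x \notin l) ->
  exists E, [/\ clopn E, forall x, x \in k -> E x & forall x, x \in l -> ~ E x].
Proof.
have sep1 x : x \notin l ->
    exists D, [/\ clopn D, D x & forall y, y \in l -> ~ D y].
  elim: l => [_|y l IH]; first by exists (~` set0); split=> //; exact: clopnC.
  rewrite inE negb_or => /andP[/clopn_sep[D [cD Dx Dy]] /IH[E [cE Ex El]]].
  exists (D `&` E); split=> //; first exact: clopnI.
  by move=> z; rewrite inE => /predU1P[->|zl] [? ?]; [exact: Dy|exact: (El z)].
elim: k => [_|x k IH kl]; first by exists set0; split=> // x _ [].
have [D [cD Dx Dl]] := sep1 x (kl _ (mem_head _ _)).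
have [|E [cE Ek El]] := IH; first by move=> y yk; apply: kl; rewrite inE yk orbT.
exists (D `|` E); split=> [|y|y yl]; first exact: clopnU.
  by rewrite inE => /predU1P[->|/Ek]; [left|right].
by case; [exact: Dl|exact: El].
Qed.

Lemma disjoint_copies N V W : clopn V -> clopn W -> W !=set0 -> V `&` W = set0 ->
  exists ts : nat -> H, [/\
    forall i, (i < N)%N -> supp (V `|` W) (ts i),
    forall i x, (i < N)%N -> V x -> W (a (ts i) x) &
    forall i j x, (i < N)%N -> (j < N)%N -> i != j ->
      V (a (ts i)^-1%g x) -> ~ V (a (ts j)^-1%g x)].
Proof.
move=> cV; elim: N W => [|N IH] W cW W0 VW; first by exists (fun=> 1%g); split.
(* Two orbit points split [W] into two nonempty clopen parts, one for this copy of [V] and one for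
   the other [N]. *)
have [g [Wg _]] := orbit_infinite [::] cW W0.
have [g' [Wg' gg']] := orbit_infinite [:: a g x0] cW W0.
move: gg'; rewrite inE => /clopn_sep[D [cD Dg' Dg]].
have cWD := clopnI cW cD; have cWD' := clopnI cW (clopnC cD).
have sub E x : V x -> ~ (W `&` E) x.
  by move=> Vx [Wx _]; have : (V `&` W) x by []; rewrite VW.
have [||t [tW tS]] := compress cV cWD; first by exists (a g' x0).
  by apply/seteqP; split=> // x [/sub]; apply.
have [||ts [tsS tsW tsD]] := IH _ cWD'.
  by exists (a g x0).
  by apply/seteqP; split=> // x [/sub]; apply.
exists (fun i => if i is j.+1 then ts j else t); split.
- move=> [|i] iN; first by apply: suppW tS => x [|[]]; [left|right].
  by apply: suppW (tsS i iN) => x [|[]]; [left|right].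
- by move=> [|i] x iN Vx; [case: (tW _ Vx)|case: (tsW i _ iN Vx)].
- move=> [|i] [|j] x // iN jN ij V1 V2.
  + by have [_] := tW _ V1; have [_] := tsW j _ jN V2; rewrite !actKV.
  + by have [_] := tW _ V2; have [_] := tsW i _ iN V1; rewrite !actKV.
  + by apply: (tsD i j x iN jN _ V1 V2).
Qed.

(** The class of the elements agreeing with [g] near [x0], encoded as a set so that equality of
    germs is plain equality. *)
Definition germ g : set H :=
  [set g' | exists D, [/\ clopn D, D x0 & forall x, D x -> a g' x = a g x]].

Definition act_germ h (y : set H) : set H := (fun g => h * g)%g @` y.

Lemma act_germM h k y : act_germ (h * k)%g y = act_germ h (act_germ k y).
Proof. by rewrite /act_germ image_comp; apply: eq_imagel => g _ /=; rewrite mulgA. Qed.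

Lemma act_germ1 y : act_germ 1%g y = y.
Proof. by rewrite /act_germ (eq_imagel (f' := id)) ?image_id // => g _; rewrite mul1g. Qed.

Lemma act_germE h g : act_germ h (germ g) = germ (h * g)%g.
Proof.
apply/seteqP; split=> [_ [g' [D [cD Dx gg'] <-]]|g' [D [cD Dx gg']]].
  by exists D; split=> // x Dx'; rewrite !actM gg'.
exists (h^-1 * g')%g; last by rewrite mulVKg.
by exists D; split=> // x Dx'; rewrite actM gg' // actM actVK.
Qed.

Lemma germ_refl g : germ g g.
Proof. by exists (~` set0); split=> //; exact: clopnC. Qed.

Lemma germ_eq g g' D : clopn D -> D x0 -> (forall x, D x -> a g x = a g' x) ->
  germ g = germ g'.
Proof.
move=> cD Dx gg'; apply/seteqP; split=> k [E [cE Ex kE]].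
  exists (D `&` E); split=> // [|x [Dx' Ex']]; first exact: clopnI.
  by rewrite kE ?gg'.
exists (D `&` E); split=> // [|x [Dx' Ex']]; first exact: clopnI.
by rewrite kE ?gg'.
Qed.

Lemma supp_fix_germ V h g : clopn V -> supp V h -> ~ V (a g x0) ->
  germ (h * g)%g = germ g.
Proof.
move=> cV hV Vg; apply: (@germ_eq _ _ [set x | ~ V (a g x)]) => //.
  exact: clopn_act (clopnC cV).
by move=> x Vx; rewrite actM hV.
Qed.

Lemma fix_germ_nbhs h g : germ (h * g)%g = germ g ->
  exists E, [/\ clopn E, E (a g x0) & forall x, E x -> a h x = x].
Proof.
move=> hg; have := germ_refl (h * g)%g; rewrite hg => -[D [cD Dx gE]].
exists [set x | D (a g^-1%g x)]; split; first exact: clopn_act.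
  by rewrite /= actVK.
by move=> x /= /gE; rewrite actM !actKV.
Qed.

(** An element fixing the germs is the identity near each framed point; removing those
    neighbourhoods from [U] leaves a support that avoids the frame. *)
Lemma fix_germs_supp U h gs : clopn U -> supp U h ->
  (forall g, g \in gs -> germ (h * g)%g = germ g) ->
  exists V, [/\ clopn V, V `<=` U, forall g, g \in gs -> ~ V (a g x0) & supp V h].
Proof.
move=> cU hU; elim: gs => [_|g gs IH gsh]; first by exists U; split.
have [|V [cV VU Vgs hV]] := IH; first by move=> k kgs; apply: gsh; rewrite inE kgs orbT.
have [E [cE Eg hE]] := fix_germ_nbhs (gsh _ (mem_head _ _)).
exists (V `&` ~` E); split=> [||k|x].
- by apply: clopnI => //; exact: clopnC.
- by move=> x [/VU].
- by rewrite inE => /predU1P[->|/Vgs Vk] [].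
- by move=> /not_andP[|/contrapT]; [exact: hV|exact: hE].
Qed.

(** Near [g x0] the element [g' g^-1] carries one germ to the other, but its support is
    uncontrolled. Exchanging a small neighbourhood with its disjoint image keeps the germ and
    confines the support to [U]; disjointness requires distinct base points. *)
Lemma swap_germ U g g' : clopn U -> U (a g x0) -> U (a g' x0) ->
  a g x0 != a g' x0 -> exists2 t, supp U t & germ (t * g)%g = germ g'.
Proof.
move=> cU Ug Ug' /clopn_sep[D [cD Dg Dg']].
pose k := (g' * g^-1)%g.
pose A := U `&` D `&` [set x | (U `&` ~` D) (a k x)].
have cA : clopn A.
  apply: clopnI; first exact: clopnI.
  by apply/clopn_act/clopnI => //; exact: clopnC.
have [|t [tA _ tN]] := swap (g := k) cA; first by move=> x [_ [_ kD]] [[_]].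
exists t.
  move=> x Ux; apply: tN => [[[]]//|[_ []]].
  by rewrite actKV.
apply: (@germ_eq _ _ [set x | A (a g x)]).
- exact: clopn_act.
- by split; [split|rewrite /= actM actVK].
- by move=> x Ax; rewrite actM tA // actM actVK.
Qed.

Definition frame U (gs : seq H) := (forall g, g \in gs -> U (a g x0)) /\
  uniq (map (fun g => a g x0) gs).

Lemma frame_fresh U (l : seq X) m : clopn U -> U !=set0 ->
  exists gs, [/\ frame U gs, size gs = m &
    forall g, g \in gs -> a g x0 \notin l].
Proof.
move=> cU U0; elim: m => [|m [gs [[gsU gsu] gsm gsl]]]; first by exists [::].
have [g [Ug]] := orbit_infinite (map (fun g => a g x0) gs ++ l) cU U0.
rewrite mem_cat negb_or => /andP[ggs gl].
exists (g :: gs); split=> /=; last 2 first.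
- by rewrite gsm.
- by move=> k; rewrite inE => /predU1P[->|/gsl].
split; last by rewrite /= ggs.
by move=> k; rewrite inE => /predU1P[->|/gsU].
Qed.

(** A clopen set [E] isolates the first pair of points from the rest, so the swap inside [E] and the
    inductive move outside it do not disturb each other. *)
Lemma frame_trans_disjoint U gs gs' : clopn U ->
  frame U gs -> frame U gs' -> size gs = size gs' ->
  (forall g g', g \in gs -> g' \in gs' -> a g x0 != a g' x0) ->
  exists2 h, supp U h & map germ gs' = map (act_germ h) (map germ gs).
Proof.
elim: gs gs' U => [|g gs IH] [|g' gs'] U cU //=.
  by exists 1%g; first exact: supp1.
move=> [gsU /= /andP[ggs gsu]] [gsU' /= /andP[ggs' gsu']] [szE] dis.
have mem_t k (ks : seq H) : k \in ks -> a k x0 \in map (fun k => a k x0) ks.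
  exact: map_f.
have mt k k' (ks : seq H) : k \in ks -> k \in k' :: ks by rewrite inE orbC => ->.
have [|E [cE Egg El]] := @clopn_sep_seq [:: a g x0; a g' x0]
    (map (fun k => a k x0) (gs ++ gs')).
  move=> x; rewrite !inE map_cat mem_cat => /orP[]/eqP ->; rewrite negb_or.
    rewrite ggs /=; apply/mapP => -[k kgs' E].
    by have := dis g k (mem_head _ _) (mt _ _ _ kgs'); rewrite E eqxx.
  rewrite ggs' andbT; apply/mapP => -[k kgs' E].
  by have := dis k g' (mt _ _ _ kgs') (mem_head _ _); rewrite E eqxx.
have nE k : k \in gs ++ gs' -> ~ E (a k x0) by move=> /mem_t/El.
have cUE := clopnI cU cE; have cUE' := clopnI cU (clopnC cE).
have [||||h1 h1S h1E] := IH gs' _ cUE'.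
- split=> // k kgs; split; first exact/gsU/mt.
  by apply: nE; rewrite mem_cat kgs.
- split=> // k kgs; split; first exact/gsU'/mt.
  by apply: nE; rewrite mem_cat kgs orbT.
- by [].
- by move=> k k' kgs kgs'; apply: dis; exact: mt.
have [|||t tS tg] := @swap_germ _ g g' cUE.
- by split; [exact/gsU/mem_head|apply: Egg; rewrite mem_head].
- by split; [exact/gsU'/mem_head|apply: Egg; rewrite !inE eqxx orbT].
- by apply: dis; exact: mem_head.
exists (t * h1)%g.
  by apply: suppM; [apply: suppW tS|apply: suppW h1S] => x [].
rewrite act_germM (act_germE h1) (supp_fix_germ cUE' h1S) => [|[_]]; last first.
  by apply; apply: Egg; rewrite mem_head.
rewrite act_germE tg; congr (_ :: _).
rewrite (eq_map (g := act_germ t \o act_germ h1)); last by move=> y; exact: act_germM.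
rewrite map_comp -h1E -map_comp; apply/eq_in_map => k kgs' /=.
rewrite act_germE (supp_fix_germ cUE tS) // => -[_].
by apply: nE; rewrite mem_cat kgs' orbT.
Qed.

(** Two frames may share base points, where no swap is possible; a third frame away from both serves
    as an intermediate stop. *)
Lemma frame_trans U gs gs' : clopn U -> U !=set0 ->
  frame U gs -> frame U gs' -> size gs = size gs' ->
  exists2 h, supp U h & map germ gs' = map (act_germ h) (map germ gs).
Proof.
move=> cU U0 fr fr' szE.
have [ks [kfr ksz kl]] := frame_fresh
  (map (fun g => a g x0) (gs ++ gs')) (size gs) cU U0.
have mem_t k (ls : seq H) : k \in ls -> a k x0 \in map (fun k => a k x0) ls.
  exact: map_f.
have [||h1 h1S h1E] := frame_trans_disjoint cU fr kfr.
- by [].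
- move=> g k ggs /kl; apply: contraNneq => <-.
  by apply: mem_t; rewrite mem_cat ggs.
have [||h2 h2S h2E] := frame_trans_disjoint cU kfr fr'.
- by rewrite ksz.
- move=> k g /kl + ggs; apply: contraNneq => ->.
  by apply: mem_t; rewrite mem_cat ggs orbT.
exists (h2 * h1)%g; first exact: suppM.
rewrite h2E h1E -[in RHS]map_comp -map_comp -map_comp; apply: eq_map => g /=.
by rewrite act_germM.
Qed.

(** This is [phi]. It is multiplicative only where the conjugates commute, namely on elements
    supported in a set with disjoint translates, hence the precomposition with a retraction [pi]
    below. *)
Fixpoint replicate (ts : nat -> H) m h : H :=
  if m is m'.+1 then (replicate ts m' h * (ts m' * h * (ts m')^-1))%g else 1%g.

Definition translate V g := [set x | V (a g^-1%g x)].

Definition copies V (ts : nat -> H) m :=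
  [set x | exists2 i, (i < m)%N & translate V (ts i) x].

Definition disjoint_translates V (ts : nat -> H) m :=
  forall i j x, (i < m)%N -> (j < m)%N -> i != j ->
    translate V (ts i) x -> ~ translate V (ts j) x.

Lemma copies_disjoint V ts m : disjoint_translates V ts m.+1 ->
  copies V ts m `&` translate V (ts m) = set0.
Proof.
move=> tsD; apply/seteqP; split=> // x [[i im Vi]].
by apply: (tsD i m) => //; [exact: ltnW|rewrite ltn_eqF].
Qed.

Lemma supp_translate V t h : supp V h -> supp (translate V t) (t * h * t^-1)%g.
Proof. by apply: supp_conj => x; rewrite /translate /= actVK. Qed.

Lemma replicate_supp V ts m h : supp V h -> supp (copies V ts m) (replicate ts m h).
Proof.
move=> hV; elim: m => [|m IH] /=; first exact: supp1.
apply: suppM; first by apply: suppW IH => x [i im ?]; exists i => //; exact: ltnW.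
by apply: suppW (@supp_translate V (ts m) h hV) => x ?; exists m.
Qed.

Lemma replicateM V ts m h h' : disjoint_translates V ts m ->
  supp V h -> supp V h' ->
  replicate ts m (h * h')%g = (replicate ts m h * replicate ts m h')%g.
Proof.
move=> + hV hV'; elim: m => [|m IH] tsD /=; first by rewrite mulg1.
rewrite IH => [|i j x im jm]; last by apply: tsD; exact: ltnW.
have E := supp_comm (copies_disjoint tsD) (@replicate_supp V ts m _ hV')
  (@supp_translate V (ts m) _ hV).
have -> : (ts m * (h * h') / ts m = (ts m * h / ts m) * (ts m * h' / ts m))%g.
  by rewrite -!mulgA mulKg.
by rewrite -[RHS]mulgA [in RHS](mulgA _ (replicate _ _ _)) -E !mulgA.
Qed.

(** * The restriction to the stabiliser of a germ *)

Section InductionStep.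
Variable n : nat.
Hypothesis acyc : forall q, (q < n.+1)%N -> uniformly_acyclic q.

(** Each further conjugate contributes one more copy of [c]: by [cocycle_additive] the pullback
    splits into those along the factors, and conjugation acts trivially on cohomology. *)
Lemma replicate_cochain m (M : R) : exists M', forall U V ts pi c,
  clopn V -> V `<=` U -> (forall i, (i < m)%N -> supp U (ts i)) ->
  disjoint_translates V ts m -> (forall g, supp V (pi g)) ->
  (forall h g, supp V h -> pi (h * g)%g = (h * pi g)%g) ->
  inv_cochain (supp U) n.+1 M c -> cocycle n.+1 c ->
  exists2 b, inv_cochain (supp V) n M' b & forall s, size s = n.+1 ->
    c (map (fun g => replicate ts m (pi g)) s) = m%:R * c s + cobd b s.
Proof.
elim: m => [|m [M1 IH]].
  exists M => U V ts pi c _ _ _ _ _ _ [cM cI] cc.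
  (* For [m = 0] the map is constant at 1, and a cone with vertex 1 is a primitive of the
     pullback. *)
  exists (fun s => c (1%g :: map (fun=> 1%g) s)).
    split=> [s sn|h s _ sn]; first by rewrite cM //= size_map sn.
    by rewrite -map_comp.
  move=> s sn /=; rewrite mul0r add0r.
  by rewrite (cocycle_cone 1%g cc) ?size_map // cobd_map.
have [M2 add] := cocycle_additive M acyc.
exists (M2 + M1 + n%:R * M) => U V ts pi c cV VU tsU tsD piV piM cI cc.
have subU i : (i < m.+1)%N -> translate V (ts i) `<=` U.
  move=> im x /VU; rewrite -{2}(actKV (ts i) x); apply: supp_stable; exact: tsU.
have AU : copies V ts m `<=` U by move=> x [i im]; apply: subU; exact: ltnW.
have AB := copies_disjoint tsD.
have [ka [la [kaA laB kaM kaK]]] := joint_retraction AB.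
have [b [bM bI] bE] := add U _ _ c ka la (clopn_act _ cV) AB AU (subU m (leqnn _))
  kaA laB kaM cI cc.
have [||b1 [b1M b1I] b1E] := IH U V ts pi c cV VU _ _ piV piM cI cc.
- by move=> i im; apply: tsU; exact: ltnW.
- by move=> i j x im jm; apply: tsD; exact: ltnW.
(* Invariance of [c] absorbs the left factor [ts m] of the conjugate. What remains, [th], is
   equivariant, so a prism joins it to the identity. *)
pose th g := (pi g * (ts m)^-1)%g.
have thM h g : supp V h -> th (h * g)%g = (h * th g)%g.
  by move=> hV; rewrite /th piM // mulgA.
pose ph g := replicate ts m.+1 (pi g).
have phJ g : joint (copies V ts m) (translate V (ts m)) (ph g).
  exists (replicate ts m (pi g)), (ts m * pi g * (ts m)^-1)%g.
  by split=> //; [exact: replicate_supp|exact: supp_translate].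
exists (fun s => b (map ph s) + b1 s + prism id th c s).
  split=> [s sn|h s hV sn].
    rewrite (le_trans (ler_normD _ _)) // lerD //; last first.
      by rewrite -sn; apply: prism_bound => u; rewrite sn; exact: (invc_bound cI).
    by rewrite (le_trans (ler_normD _ _)) // lerD ?b1M ?bM ?size_map.
  congr (_ + _ + _); last 2 first.
  - exact: b1I.
  - rewrite (@prism_map _ _ _ _ _ _ _ _ (fun x => h * x)%g) //; last first.
      by move=> x; exact: thM.
    by apply: prism_ext => u; rewrite sn; apply: (invc_inv cI); exact: suppW hV.
  rewrite -(bI (replicate ts m.+1 h) (map ph s)) ?size_map //.
    rewrite -!map_comp; congr b; apply: eq_map => g /=.
    by rewrite /ph piM // (replicateM tsD hV (piV g)).
  exists (replicate ts m h), (ts m * h * (ts m)^-1)%g.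
  by split=> //; [exact: replicate_supp|exact: supp_translate].
move=> s sn; rewrite !cobdD -cobd_map.
rewrite -(prism_homotopy id th cc sn) -bE ?size_map // map_id.
have -> : map ka (map ph s) = map (fun g => replicate ts m (pi g)) s.
  rewrite -map_comp; apply: eq_map => g /=.
  by apply: (kaK _ _ _ _).1; [exact: replicate_supp|exact: supp_translate].
have -> : map la (map ph s) = map (fun g => ts m * g)%g (map th s).
  rewrite -!map_comp; apply: eq_map => g /=; rewrite mulgA.
  by apply: (kaK _ _ _ _).2; [exact: replicate_supp|exact: supp_translate].
rewrite (invc_inv cI) ?size_map //; last exact: tsU.
rewrite b1E // -[in m.+1%:R]addn1 natrD /ph /=.
lra.
Qed.

Let J := {U : set X | clopn U /\ U !=set0}.
Let gen (i : J) (ys : seq (set H)) :=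
  exists2 gs, ys = map germ gs & frame (proj1_sig i) gs.
Let tr (i : J) h := supp (proj1_sig i) h.
Let aX h g := (h * g)%g.

Lemma framed_del i s u : gen i s -> del u s -> gen i u.
Proof.
move=> [gs -> [gsU gsu]] /del_map[ks kgs ->]; exists ks => //.
have sub := del_subseq kgs; split; last exact: subseq_uniq (map_subseq _ sub) gsu.
by move=> k /(mem_subseq sub)/gsU.
Qed.

Lemma framed_act i h s : tr i h -> gen i s -> gen i (map (act_germ h) s).
Proof.
move=> hU [gs -> [gsU gsu]]; exists (map (fun g => h * g)%g gs).
  by rewrite -!map_comp; apply: eq_map => g /=; exact: act_germE.
split=> [_ /mapP[g /gsU Ug ->]|].
  by rewrite actM; exact: supp_stable.
rewrite -map_comp (eq_map (g := a h \o (fun g => a g x0))) => [|g]; last first.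
  by rewrite /= actM.
by rewrite map_comp map_inj_uniq //; exact: can_inj (actVK h).
Qed.

(** A cone vertex must be generic against [ys] and equivariant. No single germ is generic against
    every frame, so the cones over germs avoiding larger and larger finite sets are averaged; the
    factor [pi (head 1 xs)] supplies equivariance. *)
Lemma framed_row p q (M : R) : exists M', forall i r,
  bicochain act_germ aX gen tr i p q.+1 M r ->
  eq_at gen i p.+1 q.+1 (hcobd r) (@zero2 R (set H) H) ->
  exists2 e, bicochain act_germ aX gen tr i p.-1 q.+1 M' e &
    eq_at gen i p q.+1 r (hcobd e).
Proof.
exists (Num.max M 0) => i r [rM rI] r0.
have [cU U0] := proj2_sig i.
have [|||pi [piU piM _]] := @equivariant_retraction H (supp (proj1_sig i)).
- exact: supp1.
- exact: suppM.
- exact: suppV.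
have fresh w := orbit_infinite w cU U0.
case: p rM rI r0 => [|p] rM rI r0 /=.
  exists (@zero2 R (set H) H); first by apply: bic0; rewrite le_max lexx orbT.
  move=> ys xs gy sy sx; rewrite (size0nil sy) /hcobd /=.
  have [g [Ug _]] := fresh [::].
  have := r0 [:: germ g] xs _ erefl sx; rewrite /hcobd /zero2 /= subr0; apply.
  by exists [:: g] => //; split=> // k; rewrite inE => /eqP ->.
pose z w := projT1 (cid (fresh w)).
have zP w : proj1_sig i (a (z w) x0) /\ a (z w) x0 \notin w.
  by rewrite /z; case: cid.
pose le (w w' : seq X) := {subset w <= w'}.
have [||w w'|L] := @limit_functional_exists R (seq X) le [::].
- by move=> w x.
- by move=> w1 w2 w3 w12 w23 x /w12/w23.
- by exists (w ++ w'); split=> x xl; rewrite mem_cat xl ?orbT.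
pose cone xs w := act_germ (pi (head 1%g xs)) (germ (z w)).
have coneG xs ys : gen i ys -> ultimately le (fun w => gen i (cone xs w :: ys)).
  move=> [gs -> [gsU gsu]]; pose k := pi (head 1%g xs).
  exists (map (fun g => a (k^-1 * g)%g x0) gs) => w gsw.
  exists ((k * z w)%g :: gs); first by rewrite /cone act_germE.
  have [Uz zl] := zP w; split=> [g|/=].
    rewrite inE => /predU1P[->|/gsU //].
    by rewrite actM; exact: supp_stable (piU _) Uz.
  rewrite gsu andbT; apply: contra zl => /mapP[g ggs kz].
  by apply: gsw; apply/mapP; exists g => //; rewrite actM -kz actM actVK.
exists (fun ys xs => L (fun w => r (cone xs w :: ys) xs)).
  split=> [ys xs gy sy sx|h ys xs hU gy sy sx].
    rewrite le_max lim_fun_bound //; apply: ultimatelyW (coneG xs ys gy) => w gl.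
    by rewrite rM //= sy.
  apply: lim_fun_eq; apply: ultimatelyW (coneG xs ys gy) => w gl.
  rewrite -(rI h (cone xs w :: ys) xs) //= ?sy //.
  case: xs sx gl => //= x xs sx gl.
  by rewrite /cone /= piM // act_germM.
move=> ys xs gy sy sx.
rewrite /hcobd (cobd_lim_fun L (M := M)).
  rewrite -[LHS](lim_fun_cst L); apply: lim_fun_eq.
  apply: ultimatelyW (coneG xs ys gy) => w gl.
  rewrite (cobd_cone (fun v => r v xs) (cone xs w) ys).
  have -> : cobd (fun v => r v xs) (cone xs w :: ys) = 0.
    by apply: (r0 (_ :: ys) xs gl _ sx); rewrite /= sy.
  by rewrite addr0.
apply: ultimatelyW (coneG xs ys gy) => w gl u uy.
apply: rM => //; first by apply: framed_del gl _; exact: del_cons.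
by rewrite /= -(del_size uy).
Qed.

(** By transitivity an invariant function on frames of a given length is constant. Row 0 is
    therefore one copy of the reals per degree, with differentials alternately zero and the
    identity. *)
Lemma framed_row0 p (M : R) : exists M', forall i r,
  bicochain act_germ aX gen tr i p 0 M r -> True ->
  eq_at gen i p.+1 0 (hcobd r) (@zero2 R (set H) H) ->
  exists2 e, bicochain act_germ aX gen tr i p.-1 0 M' e &
    eq_at gen i p 0 r (hcobd e).
Proof.
exists (Num.max M 0) => i r [rM rI] _ r0.
have [cU U0] := proj2_sig i.
have [gs [gsF gsp _]] := frame_fresh [::] p cU U0.
have [ks [ksF ksp _]] := frame_fresh [::] p.+1 cU U0.
pose k := r (map germ gs) [::].
have rk ys : gen i ys -> size ys = p -> r ys [::] = k.
  move=> [gs' -> fr']; rewrite size_map => sp.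
  have [|h hU ->] := frame_trans cU U0 gsF fr'; first by rewrite sp.
  by apply: (rI h (map germ gs) [::]) => //; [exists gs|rewrite size_map].
have kodd : (if odd p.+1 then k else 0) = 0.
  have gks : gen i (map germ ks) by exists ks.
  rewrite -[RHS](r0 (map germ ks) [::]) //; last by rewrite size_map.
  have {1}-> : p.+1 = size (map germ ks) by rewrite size_map.
  rewrite -cobd_cst; apply: cobd_ext => u uks; rewrite rk //.
    exact: framed_del uks.
  by apply: succn_inj; rewrite -(del_size uks) size_map.
exists (fun _ _ => k).
  split=> // ys xs _ _ _; rewrite le_max /k rM //; first by exists gs.
  by rewrite size_map.
move=> ys xs gy sy /size0nil ->; rewrite rk // /hcobd cobd_cst sy.
by move: kodd => /=; case: odd.
Qed.

(* Transitivity on frames reduces everything to a fixed frame [gs]; its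
   stabiliser is the increasing union of the groups [supp V], along which the
   solutions [F V] are averaged by [L]. *)
Lemma glue (i : J) (gs : seq H) p q (M1 M2 : R) f :
  frame (proj1_sig i) gs -> size gs = p ->
  (forall h ys xs, tr i h -> gen i ys -> size ys = p -> size xs = q ->
    f (map (act_germ h) ys) (map (aX h) xs) = f ys xs) ->
  (forall V, clopn V -> V `<=` proj1_sig i -> (forall g, g \in gs -> ~ V (a g x0)) ->
    exists c b, [/\ inv_cochain (supp V) q M1 c, inv_cochain (supp V) q.-1 M2 b &
      forall s, size s = q -> f (map germ gs) s = c s + cobd b s]) ->
  exists c b, [/\ bicochain act_germ aX gen tr i p q M1 c,
    bicochain act_germ aX gen tr i p q.-1 M2 b &
    eq_at gen i p q f (fun ys xs => c ys xs + vcobd b ys xs)].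
Proof.
move=> gsF gsp fI sol; have [cU U0] := proj2_sig i.
pose I := {V : set X | [/\ clopn V, V `<=` proj1_sig i &
  forall g, g \in gs -> ~ V (a g x0)]}.
pose le (V W : I) := proj1_sig V `<=` proj1_sig W.
pose V0 : I := exist _ set0 (And3 clopn0 (@sub0set _ _) (fun _ _ F => F)).
have [|||L] := @limit_functional_exists R I le V0.
- by move=> V.
- by move=> V1 V2 V3; exact: subset_trans.
- move=> [V [cV VU Vgs]] [W [cW WU Wgs]].
  have VW : [/\ clopn (V `|` W), V `|` W `<=` proj1_sig i &
      forall g, g \in gs -> ~ (V `|` W) (a g x0)].
    split; [exact: clopnU|by rewrite subUset|].
    by move=> g ggs [/Vgs|/Wgs]; apply.
  by exists (exist _ (V `|` W) VW); split; [exact: subsetUl|exact: subsetUr].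
have solI (V : I) : exists cb, [/\ inv_cochain (supp (proj1_sig V)) q M1 cb.1,
    inv_cochain (supp (proj1_sig V)) q.-1 M2 cb.2 &
    forall s, size s = q -> f (map germ gs) s = cb.1 s + cobd cb.2 s].
  by case: V => V [/= cV VU Vgs]; have [c [b ?]] := sol V cV VU Vgs; exists (c, b).
pose cb (V : I) := projT1 (cid (solI V)).
have cI (V : I) : inv_cochain (supp (proj1_sig V)) q M1 (cb V).1.
  by rewrite /cb; case: cid => ? [].
have bI (V : I) : inv_cochain (supp (proj1_sig V)) q.-1 M2 (cb V).2.
  by rewrite /cb; case: cid => ? [].
have cbE (V : I) s : size s = q -> f (map germ gs) s = (cb V).1 s + cobd (cb V).2 s.
  by rewrite /cb; case: cid => ? /= [_ _]; apply.
have mvE ys : exists h, gen i ys -> size ys = p ->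
    tr i h /\ ys = map (act_germ h) (map germ gs).
  have [[[gs' -> fr'] sp]|ny] := pselect (gen i ys /\ size ys = p).
    have [|h hU hE] := frame_trans cU U0 gsF fr'.
      by rewrite gsp -sp size_map.
    by exists h.
  by exists 1%g => gy sy; case: ny.
pose mv ys := projT1 (cid (mvE ys)).
have mvU ys : gen i ys -> size ys = p -> tr i (mv ys).
  by rewrite /mv; case: cid => h hP gy sy; case: (hP gy sy).
have mvP ys : gen i ys -> size ys = p -> ys = map (act_germ (mv ys)) (map germ gs).
  by rewrite /mv; case: cid => h hP gy sy; case: (hP gy sy).
pose back ys := map (fun g => (mv ys)^-1 * g)%g.
have average m M (F : I -> seq H -> R) :
    (forall V : I, inv_cochain (supp (proj1_sig V)) m M (F V)) ->
    bicochain act_germ aX gen tr i p m M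
      (fun ys xs => L (fun V : I => F V (back ys xs))).
  move=> FI; split=> [ys xs gy sy sx|h ys xs hU gy sy sx].
    apply: lim_fun_bound; exists V0 => V _.
    by apply: (invc_bound (FI V)); rewrite size_map.
  pose ys' := map (act_germ h) ys.
  have gy' : gen i ys' by exact: framed_act.
  have sy' : size ys' = p by rewrite size_map.
  (* The chosen transporters [mv] are not equivariant; the defect [k] fixes the germs of [gs], so it
     lies in [supp V] for some [V] and the averaged families are [k]-invariant from [V] on. *)
  pose k := ((mv ys')^-1 * h * mv ys)%g.
  have kU : supp (proj1_sig i) k.
    by apply: suppM (mvU _ gy sy); apply: suppM hU; exact: suppV (mvU _ gy' sy').
  have [|V [cV VU Vgs kV]] := @fix_germs_supp _ k gs cU kU.
    have : map (act_germ k) (map germ gs) = map germ gs.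
      transitivity (map (act_germ (mv ys')^-1%g) ys'); last first.
        rewrite {2}(mvP _ gy' sy') -map_comp -[RHS]map_id; apply: eq_map => y /=.
        by rewrite -act_germM mulVg act_germ1.
      rewrite /ys' {2}(mvP _ gy sy) -!map_comp; apply: eq_map => y /=.
      by rewrite /k !act_germM.
    rewrite -map_comp => /eq_in_map kgs g /kgs /=.
    by rewrite act_germE.
  pose VI : I := exist _ V (And3 cV VU Vgs).
  apply: lim_fun_eq; exists VI => W VW.
  rewrite -(invc_inv (FI W) (h := k) (s := back ys xs)) ?size_map //; last first.
    exact: suppW kV.
  congr (F W _); rewrite /back -!map_comp; apply: eq_map => g /=.
  by rewrite /aX /k -!mulgA mulVKg.
exists (fun ys xs => L (fun V : I => (cb V).1 (back ys xs))).
exists (fun ys xs => L (fun V : I => (cb V).2 (back ys xs))).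
split; [exact: (average _ _ (fun V : I => (cb V).1) cI)|
  exact: (average _ _ (fun V : I => (cb V).2) bI)|].
move=> ys xs gy sy sx; rewrite /vcobd.
have bb (V : I) :
    `|cobd (fun u => (cb V).2 (back ys u)) xs| <= (size xs)%:R * M2.
  apply: cobd_bound => u ux; apply: (invc_bound (bI V)).
  by rewrite size_map -sx (del_size ux).
rewrite (cobd_lim_fun L (M := M2)); last first.
  exists V0 => V _ u ux; apply: (invc_bound (bI V)).
  by rewrite size_map -sx (del_size ux).
rewrite -(lim_funD L (M := Num.max M1 ((size xs)%:R * M2))); last 2 first.
- exists V0 => V _; rewrite le_max (invc_bound (cI V)) //.
  by rewrite size_map.
- by exists V0 => V _; rewrite le_max bb orbT.
rewrite -[LHS](lim_fun_cst L); congr (L _); apply/funext => V.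
rewrite -cobd_map -cbE ?size_map //.
rewrite {1}(mvP _ gy sy) -(fI (mv ys)^-1%g) ?size_map //; last 2 first.
- exact: suppV (mvU _ gy sy).
- by rewrite -(mvP _ gy sy).
congr (f _ _); rewrite -!map_comp; apply: eq_map => g /=.
by rewrite -act_germM mulVg act_germ1.
Qed.

Lemma framed_inv i p q (M : R) f gs V h s : bicochain act_germ aX gen tr i p q M f ->
  frame (proj1_sig i) gs -> size gs = p -> clopn V -> V `<=` proj1_sig i ->
  (forall g, g \in gs -> ~ V (a g x0)) -> supp V h -> size s = q ->
  f (map germ gs) (map (fun g => h * g)%g s) = f (map germ gs) s.
Proof.
move=> [_ fI] gsF gsp cV VU Vgs hV sq.
rewrite -[RHS](fI h) ?size_map //; last by exists gs.
  congr (f _ _); rewrite -map_comp; apply/eq_in_map => g /Vgs /= Vg.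
  by rewrite act_germE (supp_fix_germ cV hV Vg).
exact: suppW hV.
Qed.

Lemma framed_col p q (M : R) : (q < n.+1)%N -> exists M', forall i f,
  bicochain act_germ aX gen tr i p.+1 q M f ->
  eq_at gen i p.+1 q.+1 (vcobd f) (@zero2 R (set H) H) ->
  exists2 b, bicochain act_germ aX gen tr i p.+1 q.-1 M' b &
    eq_at gen i p.+1 q f (vcobd b).
Proof.
move=> qn; have [M' acycM] := acyc qn M; exists M' => i f fA f0.
have [cU U0] := proj2_sig i.
have [gs [gsF gsp _]] := frame_fresh [::] p.+1 cU U0.
have gy : gen i (map germ gs) by exists gs.
have sy : size (map germ gs) = p.+1 by rewrite size_map.
(* With bound 0 the summand [c] of [glue] vanishes, leaving a pure primitive. *)
have [|V cV VU Vgs|c [b [[c0 _] bA fE]]] := @glue i gs p.+1 q 0 M' f gsF gsp.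
- by case: fA.
- have [||b bI bE] := acycM V (f (map germ gs)) cV.
  + split=> [s sq|h s hV sq]; first by case: fA => fM _; exact: fM.
    exact: (framed_inv fA gsF gsp cV).
  + by move=> s sq; exact: f0.
  exists (fun=> 0), b; split=> // [|s sq]; first by split=> // s _; rewrite normr0.
  by rewrite add0r bE.
exists b => // ys xs gys sys sx; rewrite fE //.
by have := c0 ys xs gys sys sx; rewrite normr_le0 => /eqP ->; rewrite add0r.
Qed.

(** List length [n.+1] is beyond the inductive hypothesis. For two germs, some [t] supported off [V]
    carries one to the other and commutes with [supp V], so the two restrictions of [r] differ by
    left translation by [t^-1], which a prism trivialises. *)
Lemma framed_swap (M : R) : exists M', forall i r,
  bicochain act_germ aX gen tr i 1 n.+1 M r ->
  eq_at gen i 1 n.+2 (vcobd r) (@zero2 R (set H) H) ->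
  exists2 s, bicochain act_germ aX gen tr i 2 n M' s &
    eq_at gen i 2 n.+1 (hcobd r) (vcobd s).
Proof.
exists (n%:R * M) => i r rA r0.
have [cU U0] := proj2_sig i.
have [gs [+ + _]] := frame_fresh [::] 2 cU U0.
case: gs => [//|g [//|g' [|//]]] gsF gsp.
have [|V cV VU Vgs|c [b [[c0 _] bA fE]]] :=
    @glue i [:: g; g'] 2 n.+1 0 (n%:R * M) (hcobd r) gsF gsp.
- by have [] := bic_hcobd framed_del rA.
- have gF : frame (proj1_sig i) [:: g].
    split=> // k; rewrite inE => /eqP ->.
    by case: gsF => gsU _; apply: gsU; rewrite mem_head.
  have Vg k : k \in [:: g] -> ~ V (a k x0).
    by rewrite inE => /eqP ->; apply: Vgs; rewrite mem_head.
  have [||||t tS tg] := @swap_germ (proj1_sig i `&` ~` V) g g'.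
  + by apply: clopnI => //; exact: clopnC.
  + by split; [case: gsF => gsU _; apply: gsU|apply: Vgs]; rewrite mem_head.
  + by split; [case: gsF => gsU _; apply: gsU|apply: Vgs]; rewrite !inE eqxx orbT.
  + by case: gsF => _; rewrite /= inE andbT.
  pose c := r [:: germ g].
  have cM u : size u = n.+1 -> `|c u| <= M.
    by case: rA => rM _ sn; apply: rM => //; exists [:: g].
  exists (fun=> 0), (prism id (fun k => t^-1 * k)%g c); split.
  + by split=> // s _; rewrite normr0.
  + split=> [s /= sn|h s hV /= sn].
      by rewrite -[n in n%:R]sn; apply: prism_bound => u; rewrite sn; exact: cM.
    have tV : supp (proj1_sig i `&` ~` V) t^-1%g by exact: suppV.
    have UV : (proj1_sig i `&` ~` V) `&` V = set0.
      by apply/seteqP; split=> // x [[_ nV]] /nV.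
    rewrite (@prism_map _ _ _ _ _ _ _ _ (fun x => h * x)%g) //; last first.
      by move=> x; rewrite !mulgA (supp_comm UV tV hV).
    apply: prism_ext => u; rewrite sn => un.
    exact: (framed_inv rA gF _ cV).
  + move=> s sn; rewrite add0r -(prism_homotopy id (fun k => t^-1 * k)%g (n := n.+1)) //.
      rewrite map_id /c /hcobd /= subr0; congr (_ - _).
      case: rA => _ rI; rewrite -[RHS](rI t [:: germ g]) //; last 3 first.
      * by apply: suppW tS => x [].
      * by exists [:: g].
      * by rewrite size_map.
      rewrite /= act_germE tg -map_comp; congr r.
      by rewrite -[LHS]map_id; apply: eq_map => k /=; rewrite /aX mulVKg.
    by move=> u un; apply: r0 => //; exists [:: g].
exists b => // ys xs gys sys sx; rewrite fE //.
by have := c0 ys xs gys sys sx; rewrite normr_le0 => /eqP ->; rewrite add0r.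
Qed.

(** Here [d] averages the pullbacks along [phi]: its bound is [M] for every [N], and the dependence
    on [N] is confined to [M']. The framed point, lying outside [V], guarantees room for the copies
    in the complement of [V] in [U]. *)
Lemma framed_replicate N (M : R) : exists M', forall i c,
  inv_cochain (tr i) n.+1 M c -> cocycle n.+1 c ->
  exists d b, [/\ bicochain act_germ aX gen tr i 1 n.+1 M d,
    bicochain act_germ aX gen tr i 1 n M' b &
    eq_at gen i 1 n.+1 (fun _ xs => N%:R * c xs)
      (fun ys xs => d ys xs + vcobd b ys xs)].
Proof.
have [M' rep] := replicate_cochain N M.
exists M' => i c cI cc.
have [cU U0] := proj2_sig i.
have [gs [+ + _]] := frame_fresh [::] 1 cU U0.
case: gs => [//|g [|//]] gF gsp.
apply: (@glue i [:: g] 1 n.+1 M M' (fun _ xs => N%:R * c xs) gF gsp).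
  by move=> h ys xs hU _ _ sx; rewrite (invc_inv cI).
move=> V cV VU Vg.
have Ug : proj1_sig i (a g x0) by case: gF => gU _; apply: gU; rewrite mem_head.
have [|||ts [tsS tsW tsD]] := @disjoint_copies N V (proj1_sig i `&` ~` V) cV.
- by apply: clopnI => //; exact: clopnC.
- by exists (a g x0); split=> //; apply: Vg; rewrite mem_head.
- by apply/seteqP; split=> // x [Vx [_]] /(_ Vx).
have tsU j : (j < N)%N -> supp (proj1_sig i) (ts j).
  by move=> /tsS; apply: suppW => x [/VU|[]].
have [|||pi [piV piM _]] := @equivariant_retraction H (supp V).
- exact: supp1.
- exact: suppM.
- exact: suppV.
have [b bI bE] := rep _ _ ts pi c cV VU tsU tsD piV piM cI cc.
have repU h : supp V h -> supp (proj1_sig i) (replicate ts N h).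
  move=> hV; elim: (N) tsU => [|m IH] tsU' /=; first exact: supp1.
  apply: suppM; first by apply: IH => k km; apply: tsU'; exact: ltnW.
  apply: suppM; last by apply/suppV/tsU'.
  by apply: suppM; [exact: tsU'|exact: suppW hV].
exists (fun s => c (map (fun g => replicate ts N (pi g)) s)), (fun s => - b s).
split.
- case: cI => cM cI; split=> [s sn|h s hV sn]; first by rewrite cM // size_map.
  rewrite -(cI _ (map _ s) (repU _ hV)) ?size_map // -!map_comp; congr c.
  by apply: eq_map => k /=; rewrite piM // (replicateM tsD hV (piV k)).
- case: bI => bM bI; split=> [s sn|h s hV sn]; first by rewrite normrN bM.
  by rewrite bI.
- by move=> s sn; rewrite bE // cobdN addrK.
Qed.

(** The constant [C] precedes [N]. Two zigzags are run: one extends [d] from the stabiliser of a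
    germ to a cochain of the whole group, the other compares that extension with [N c]. *)
Lemma reduce_norm : exists C : R, forall N, exists M, forall U c,
  clopn U -> U !=set0 -> inv_cochain (supp U) n.+1 1 c -> cocycle n.+1 c ->
  exists c' e, [/\ inv_cochain (supp U) n.+1 C c', inv_cochain (supp U) n M e &
    forall s, size s = n.+1 -> N%:R * c s = c' s + cobd e s].
Proof.
have [Ms sw] := framed_swap 1.
have zz p (M : R) := zigzag framed_del (good := fun _ _ _ _ _ => True)
  (fun _ _ _ _ _ _ _ _ => I) framed_row framed_row0 framed_col
  (fun _ _ _ => ex_intro _ 0 (fun _ _ _ _ _ _ _ => I)) p M (leqnn n.+1).
(* Only the bounds on [d] and on its swap primitive enter here, and neither involves [N]. *)
have [C zz1] := zz 1%N (Num.max 1 Ms).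
exists C => N; have [Mb rep] := framed_replicate N 1.
have [M zz0] := zz 0%N (Num.max (N%:R + C) (Mb + C)).
exists M => U c cU U0 cI cc.
pose i : J := exist _ U (conj cU U0).
have [d [b [dA bA dbE]]] := rep i c cI cc.
have d0 : eq_at gen i 1 n.+2 (vcobd d) (@zero2 R (set H) H).
  move=> ys xs gy sy sx; rewrite /vcobd.
  rewrite (cobd_ext_size (n := n.+1) (g := fun s => N%:R * c s - cobd (b ys) s)) //.
    by rewrite cobdB cobdZ cc // [X in _ - X]cobdK mulr0 subr0.
  by move=> u un; have /= -> := dbE ys u gy sy un; rewrite /vcobd addrK.
have [s sA sE] := sw i d dA d0.
have [||e0 [f0 [e0A f0A def]]] := zz1 i d s _ Logic.I _ sE.
- by apply: bic_le dA; rewrite le_max lexx.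
- by apply: bic_le sA; rewrite le_max lexx orbT.
(* On a single germ [hcobd e0] is [e0 [::]], so [N c - e0 [::]] has a vertical primitive in column 1
   and the zigzag can restart from column 0. *)
have [|||e [f [_ [fM fI] ef]]] := zz0 i (fun ys xs => N%:R * c xs - e0 [::] xs)
    (fun ys xs => b ys xs + f0 ys xs) _ Logic.I.
- have [e0M e0I] := e0A; have [cM cinv] := cI.
  have g0 : gen i [::] by exists [::].
  split=> [ys xs gy sy sx|h ys xs hU gy sy sx].
    rewrite le_max; apply/orP; left; rewrite (le_trans (ler_normB _ _)) // lerD //.
      by rewrite normrM ger0_norm ?ler0n // ler_piMr ?ler0n // cM.
    exact: e0M.
  by congr (_ * _ - _); [exact: cinv|exact: (e0I h [::])].
- by apply: bic_le (bicD bA f0A); rewrite le_max lexx orbT.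
- move=> ys xs gy; case: ys gy => // y [|//] gy sy sx.
  rewrite /hcobd /vcobd /= subr0 cobdD.
  have E1 := dbE [:: y] xs gy sy sx; have E2 := def [:: y] xs gy sy sx.
  move: E1 E2; rewrite /hcobd /vcobd /= subr0; lra.
exists (e0 [::]), (f [::]); split.
- case: e0A => e0M e0I; split=> [xs sx|h xs hU sx]; first by apply: e0M => //; exists [::].
  by apply: (e0I h [::]) => //; exists [::].
- split=> [xs sx|h xs hU sx]; first by apply: fM => //; exists [::].
  by apply: (fI h [::]) => //; exists [::].
- move=> xs sx; have := ef [::] xs _ erefl sx; rewrite /hcobd /vcobd /= => E.
  have {}E := E (ex_intro2 _ _ [::] erefl (conj (fun _ F => False_ind _ (notF F)) erefl)).
  by move: E; lra.
Qed.

End InductionStep.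

(** * From halving the norm to a bounded primitive *)

Section Contraction.
Variable n : nat.
Hypothesis acyc : forall q, (q < n.+1)%N -> uniformly_acyclic q.

Lemma invcZ (P : H -> Prop) q (k M : R) (f : seq H -> R) : 0 <= k ->
  inv_cochain P q M f -> inv_cochain P q (k * M) (fun s => k * f s).
Proof.
move=> k0 [fM fI]; split=> [s sq|h s Ph sq]; last by rewrite fI.
by rewrite normrM ger0_norm // ler_wpM2l // fM.
Qed.

Lemma halve_norm : exists M : R, forall U c,
  clopn U -> U !=set0 -> inv_cochain (supp U) n.+1 1 c -> cocycle n.+1 c ->
  exists c' e, [/\ inv_cochain (supp U) n.+1 2^-1 c', inv_cochain (supp U) n M e &
    forall s, size s = n.+1 -> c s = c' s + cobd e s].
Proof.
have [C red] := reduce_norm acyc.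
pose N := (Num.bound (2 * `|C|)).+1.
have NC : 2 * `|C| <= N%:R :> R.
  have /ltW/le_trans -> // : 2 * `|C| < (Num.bound (2 * `|C|))%:R.
    by apply: archi_boundP; rewrite mulr_ge0.
  by rewrite ler_nat.
have N0 : 0 < N%:R :> R by rewrite ltr0n.
have [M redN] := red N.
exists (N%:R^-1 * M) => U c cU U0 cI cc.
have [c' [e [c'I eI ce]]] := redN U c cU U0 cI cc.
exists (fun s => N%:R^-1 * c' s), (fun s => N%:R^-1 * e s); split.
- apply: invc_le (invcZ _ c'I); last by rewrite invr_ge0 ltW.
  rewrite ler_pdivrMl // (le_trans (ler_norm _)) //.
  by rewrite ler_pdivlMr // mulrC.
- by apply: (invcZ _ eI); rewrite invr_ge0 ltW.
- by move=> s sn; rewrite cobdZ -mulrDr -ce // mulKf // gt_eqF.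
Qed.

Lemma iterated_halving : exists M : R, forall U (k : nat) c,
  clopn U -> U !=set0 -> inv_cochain (supp U) n.+1 1 c -> cocycle n.+1 c ->
  exists e, inv_cochain (supp U) n M e /\
    forall s, size s = n.+1 -> `|c s - cobd e s| <= (2 ^ k)%:R^-1.
Proof.
have [C hv] := halve_norm.
(* The bound solves [B = |C| + B / 2]: each round adds a primitive of size [|C|] and halves the
   later ones. *)
exists (2 * `|C|) => U k c cU U0; elim: k c => [|k IH] c cI cc.
  exists (fun=> 0); split=> [|s sn].
    by split=> // s _; rewrite normr0 mulr_ge0.
  by rewrite cobd0 subr0 invr1; case: cI => cM _; exact: cM.
have [c' [e [c'I eI ce]]] := hv U c cU U0 cI cc.
have [||e' [e'I e'E]] := IH (fun s => 2 * c' s).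
- by apply: invc_le (invcZ (ler0n R 2) c'I); lra.
- move=> s sn; rewrite cobdZ (cobd_ext_size (n := n.+1) (g := fun s => c s - cobd e s)) //.
    by rewrite cobdB cc // cobdK subr0 mulr0.
  by move=> u un; rewrite ce // addrK.
exists (fun s => e s + 2^-1 * e' s); split.
  case: eI e'I => eM eI [e'M e'I]; split=> [s sn|h s hU sn]; last by rewrite eI ?e'I.
  have := eM s sn; have := e'M s sn; have := ler_norm C.
  rewrite !ler_norml => ? /andP[? ?] /andP[? ?]; apply/andP; split; lra.
move=> s sn; rewrite cobdD cobdZ ce // opprD addrA addrK.
have -> : c' s - 2^-1 * cobd e' s = 2^-1 * (2 * c' s - cobd e' s) by lra.
have h0 : 0 <= 2^-1 :> R by lra.
by rewrite expnS natrM invfM normrM (ger0_norm h0); apply: ler_wpM2l => //; exact: e'E.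
Qed.

Lemma acyclic_step : uniformly_acyclic n.+1.
Proof.
have [C0 it] := iterated_halving; pose C := `|C0|.
move=> M; pose K := Num.max M 1.
have K0 : 0 < K by rewrite lt_max ltr01 orbT.
exists (Num.max M (K * C)) => U f cU fI fc.
(* An empty support makes the group trivial, so any cone is invariant. *)
have [U0|/set0P U0] := eqVneq U set0.
  exists (fun s => f (1%g :: s)); last by move=> s; exact: cocycle_cone fc.
  apply: (@invc_le _ _ M); first by rewrite le_max lexx.
  case: fI => fM _; split=> [s sn|h s hU sn]; first by rewrite fM //= sn.
  have -> : h = 1%g by apply: faithful => x; apply: hU; rewrite U0.
  by rewrite (eq_map (@mul1g H)) map_id.
pose c s := K^-1 * f s.
have cI : inv_cochain (supp U) n.+1 1 c.
  apply: invc_le (invcZ _ fI); last by rewrite invr_ge0 ltW.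
  by rewrite ler_pdivrMl // mulr1 le_max lexx.
have cc : cocycle n.+1 c by move=> s sn; rewrite cobdZ fc // mulr0.
pose e (k : nat) := projT1 (cid (it U k c cU U0 cI cc)).
have eI (k : nat) : inv_cochain (supp U) n C (e k).
  by rewrite /e; case: cid => ? /= [eI _]; apply: invc_le eI; exact: ler_norm.
have eE (k : nat) s : size s = n.+1 -> `|c s - cobd (e k) s| <= (2 ^ k)%:R^-1.
  by rewrite /e; case: cid => ? /= [_]; apply.
have [|||L] := @limit_functional_exists R nat (fun i j => (i <= j)%N) 0%N.
- by [].
- by move=> i j k; exact: leq_trans.
- by move=> i j; exists (maxn i j); rewrite leq_maxl leq_maxr.
exists (fun s => K * L (fun k : nat => e k s)).
  apply: (@invc_le _ _ (K * C)); first by rewrite le_max lexx orbT.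
  apply: invcZ (ltW K0) _; split=> [s sn|h s hU sn].
    by apply: lim_fun_bound; exists 0%N => k _; case: (eI k) => eM _; exact: eM.
  by apply: lim_fun_eq; exists 0%N => k _; case: (eI k) => _; apply.
move=> s sn; rewrite cobdZ (cobd_lim_fun L (M := C)); last first.
  exists 0%N => k _ u us; case: (eI k) => eM _; apply: eM.
  by apply: succn_inj; rewrite -(del_size us).
apply: (mulfI (lt0r_neq0 (_ : 0 < K^-1))); first by rewrite invr_gt0.
rewrite mulKf ?gt_eqF // -[LHS]/(c s); apply/eqP; rewrite -subr_eq0 -normr_le0.
have bnd m : `|c s - L (fun k : nat => cobd (e k) s)| <= (2 ^ m)%:R^-1.
  rewrite -[X in X - _](lim_fun_cst L) -(lim_funB L (M := 1 + `|c s|)).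
  - apply: lim_fun_bound; exists m => k mk.
    apply: le_trans (eE k s sn) _.
    by rewrite lef_pV2 ?posrE ?ltr0n ?expn_gt0 // ler_nat leq_exp2l.
  - by exists 0%N => k _; lra.
  - exists 0%N => k _; have := eE k s sn.
    have : ((2 ^ k)%:R^-1 <= 1 :> R) by rewrite invf_le1 ?ler1n ?ltr0n expn_gt0.
    have := ler_normB (c s) (c s - cobd (e k) s); rewrite subKr.
    lra.
rewrite leNgt; apply/negP => d0.
set d := `|_| in bnd d0.
(* A positive defect [d] would exceed [2^-m] once [m] is beyond [1/d]. *)
have := bnd (Num.bound d^-1); rewrite leNgt => /negP; apply.
rewrite invf_plt ?posrE ?ltr0n ?expn_gt0 //.
have /lt_le_trans : d^-1 < (Num.bound d^-1)%:R by apply: archi_boundP; rewrite invr_ge0 ltW.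
by apply; rewrite ler_nat ltnW // ltn_expl.
Qed.

End Contraction.

(** At length 0 the cocycle condition on a one-entry list already says that [f [::]] is zero. *)
Lemma acyclic_all q : uniformly_acyclic q.
Proof.
elim/ltn_ind: q => [[_|q IH]]; last exact: acyclic_step.
move=> M; exists 0 => U f cU _ fc.
exists (fun=> 0); first by split=> // s _; rewrite normr0.
by move=> s /size0nil ->; have := fc [:: 1%g] erefl; rewrite /= subr0.
Qed.

End RigidStabilisers.

(** * Twisted Brin-Thompson groups act richly on the Cantor cube *)

Section CantorCube.
Variable S : choiceType.
Local Notation X := (cantor_cube S).
Implicit Types (x y z : X) (l : seq (S * nat)).

Definition cylinder l x : set X := [set y | forall c, c \in l -> y c.1 c.2 = x c.1 c.2].

Lemma clopen_setC (A : set X) : clopen A -> clopen (~` A).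
Proof. exact: clopenC. Qed.

Lemma clopen_setI (A B : set X) : clopen A -> clopen B -> clopen (A `&` B).
Proof. exact: clopenI. Qed.

Lemma coord_clopen (s : S) (k : nat) (b : bool) : clopen [set y : X | y s k = b].
Proof.
have cont : continuous (fun y : X => y s k).
  move=> y; apply: (@continuous_comp X cantor_space bool (proj s) (proj k)).
    exact: (@proj_continuous S (fun=> cantor_space)).
  exact: (@proj_continuous nat (fun=> bool)).
apply: (@preimage_clopen _ _ (fun y : X => y s k) [set b]); last exact: cont.
by split; [exact: discrete_open|exact: discrete_closed].
Qed.

Lemma cylinder_clopen l x : clopen (cylinder l x).
Proof.
elim: l => [|c l IH].
  rewrite (_ : cylinder _ _ = setT); first exact: clopenT.
  by apply/seteqP; split.
rewrite (_ : cylinder _ _ = [set y | y c.1 c.2 = x c.1 c.2] `&` cylinder l x).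
  by apply: clopenI => //; exact: coord_clopen.
apply/seteqP; split=> [y yc|y [yc yl] d].
  split; first by apply: yc; rewrite mem_head.
  by move=> d dl; apply: yc; rewrite inE dl orbT.
by rewrite inE => /predU1P[->|/yl].
Qed.

Lemma cylinder_refl l x : cylinder l x x.
Proof. by []. Qed.

Lemma cylinder_cat l l' x y :
  cylinder (l ++ l') x y <-> cylinder l x y /\ cylinder l' x y.
Proof.
split=> [xy|[xl xl'] c]; last by rewrite mem_cat => /orP[/xl|/xl'].
by split=> c cl; apply: xy; rewrite mem_cat cl ?orbT.
Qed.

Lemma cube_compact : compact [set: X].
Proof.
have := @tychonoff S (fun=> cantor_space) _ (fun=> cantor_space_compact).
by congr (compact _); rewrite eqEsubset.
Qed.

Lemma cube_finite_cover (O : X -> set X) :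
  (forall x, open (O x)) -> (forall x, O x x) ->
  exists l : seq X, forall x, exists2 y, y \in l & O y x.
Proof.
move=> oO xO; have mx := isPointed.Build X (fun _ _ => false).
pose PX : ptopologicalType := HB.pack X mx.
have : @cover_compact PX setT by rewrite -compact_cover; exact: cube_compact.
move=> /(_ _ [set: X] O (fun x _ => oO x)) [|F _ cov].
  by move=> x _; exists x.
by exists (finmap.enum_fset F) => x; have [y yF Oyx] := cov x I; exists y.
Qed.

(** Every point outside [U] differs from [x] in some coordinate; by compactness finitely many such
    coordinates suffice. *)
Lemma open_cylinder (U : set X) x : open U -> U x ->
  exists l, cylinder l x `<=` U.
Proof.
move=> oU Ux.
have sep y : exists l, ~ U y -> exists2 c, c \in l & y c.1 c.2 <> x c.1 c.2.
  have [Uy|nUy] := pselect (U y); first by exists [::].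
  have [[s k] yx] : exists c : S * nat, y c.1 c.2 <> x c.1 c.2.
    apply: contrapT => /forallNP xy; apply: nUy; suff -> : y = x by [].
    apply/funext => s; apply/funext => k; apply: contrapT.
    exact: (xy (s, k)).
  by exists [:: (s, k)] => _; exists (s, k); rewrite ?mem_head.
pose L y := projT1 (cid (sep y)).
have LP y : ~ U y -> exists2 c, c \in L y & y c.1 c.2 <> x c.1 c.2.
  by rewrite /L; case: cid.
pose O y := if `[< U y >] then U else cylinder (L y) y.
have [y|y|ys cov] := @cube_finite_cover O.
- by rewrite /O; case: asboolP => // _; case: (cylinder_clopen (L y) y).
- by rewrite /O; case: asboolP.
exists (flatten (map L ys)) => z zx; have [y yys] := cov z.
rewrite /O; case: asboolP => // /LP[c cl yx] zy; case: yx.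
rewrite -zy // zx //; apply/flattenP; exists (L y) => //; exact: map_f.
Qed.

Lemma brick_of_cylinder l x : exists p : brick_index S,
  brick p x /\ brick p `<=` cylinder l x.
Proof.
pose m := (\max_(c <- l) c.2).+1.
pose w s : seq bool := if s \in map fst l then mkseq (x s) m else [::].
have wfin : finite_set [set s | w s <> [::]].
  apply: (@sub_finite_set _ _ [set` map fst l]); last exact: finite_seq.
  by move=> s /=; rewrite /w; case: ifP.
exists (BrickIndex wfin); split=> [s k|y yb c cl]; rewrite /= /w.
  by case: ifP => // _; rewrite size_mkseq => km; rewrite nth_mkseq.
have sl : c.1 \in map fst l by exact: map_f.
have cm : (c.2 < m)%N by rewrite ltnS; exact: leq_bigmax_seq.
have := yb c.1 c.2; rewrite /= /w sl size_mkseq nth_mkseq // => /(_ cm) <-.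
by [].
Qed.

Lemma brick_cylinder (p : brick_index S) x : brick p x ->
  exists l, brick p = cylinder l x.
Proof.
move=> px; have /finite_seqP[F pF] := brick_word_finite p.
exists [seq (s, k) | s <- F, k <- iota 0 (size (p s))].
apply/seteqP; split=> [y py c /allpairsPdep[s [k [sF]]]|y xy s k ks].
  by rewrite mem_iota => /andP[_ ks] -> /=; rewrite -py // -px.
rewrite px // -(xy (s, k)) //; apply/allpairsPdep; exists s, k; split=> //.
  suff : [set` F] s by [].
  by rewrite -pF /=; case: (p s) ks.
by rewrite mem_iota.
Qed.

Lemma brick_clopen (p : brick_index S) : clopen (brick p).
Proof.
have /brick_cylinder[l ->] := @brick_map_in S p (fun _ _ => false).
exact: cylinder_clopen.
Qed.

Lemma open_brick (U : set X) x : open U -> U x ->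
  exists p : brick_index S, brick p x /\ brick p `<=` U.
Proof.
move=> oU /(open_cylinder oU)[l lU]; have [p [px pl]] := brick_of_cylinder l x.
by exists p; split=> //; exact: subset_trans lU.
Qed.

Lemma cube_continuous (f : X -> X) :
  (forall x s k, exists l, forall y, cylinder l x y -> f y s k = f x s k) ->
  continuous f.
Proof.
move=> fl x A; rewrite nbhsE => -[U [oU Ufx] UA].
have [l lU] := open_cylinder oU Ufx.
have [l' l'l] : exists l', forall y, cylinder l' x y -> cylinder l (f x) (f y).
  elim: l {lU} => [|[s k] l [l1 IH]]; first by exists [::].
  have [l2 l2f] := fl x s k; exists (l1 ++ l2) => y /cylinder_cat[/IH yl /l2f yf] c.
  by rewrite inE => /predU1P[->|/yl].
suff : nbhs x (f @^-1` A) by [].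
apply: (@filterS _ _ _ (cylinder l' x)); first by move=> y /l'l/lU/UA.
by apply: open_nbhs_nbhs; split; [exact: (proj1 (cylinder_clopen l' x))|exact: cylinder_refl].
Qed.

End CantorCube.

(** * Local characterisation of twisted Brin-Thompson elements, and their dynamics *)

Section LocallyTwisted.
Variables (S : choiceType) (G : groupType) (a : group_action G S).
Local Notation X := (cantor_cube S).
Implicit Types (x y z : X) (f : X -> X) (p q : brick_index S).

(** A pointwise form of membership: it can be checked on clopen pieces separately, and partitions
    into bricks are recovered by compactness. *)
Definition locally_twisted f x :=
  exists p g q, brick p x /\ twist_piece a f p g q.

Lemma locally_twisted_sub f x p' : locally_twisted f x -> brick p' x ->
  exists p g q, [/\ brick p x, brick p `<=` brick p' & twist_piece a f p g q].
Proof.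
move=> [p [g [q [px fp]]]] p'x.
exists (brick_index_cat p (brick_index_drop p p')), g.
exists (brick_index_cat q (brick_index_act a g (brick_index_drop p p'))).
split=> [|y|y]; first exact/(brick_cat_drop _ px p'x).
  by move/(brick_cat_drop _ px p'x) => [].
by rewrite !brick_map_cat fp twist_brick_map.
Qed.

Lemma locally_twisted_ext (U : set X) f f' x : open U -> U x ->
  (forall y, U y -> f y = f' y) -> locally_twisted f x -> locally_twisted f' x.
Proof.
move=> oU Ux ff' fx; have [p' [p'x p'U]] := open_brick oU Ux.
have [p [g [q [px pp' fp]]]] := locally_twisted_sub fx p'x.
exists p, g, q; split=> // y; rewrite -fp ff' //.
exact/p'U/pp'/brick_map_in.
Qed.

Lemma locally_twisted_id x : locally_twisted id x.
Proof.
exists (brick_index0 S), 1%g, (brick_index0 S); split; first by [].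
by move=> y; rewrite brick_index0E twist1.
Qed.

Lemma locally_twisted_brick_map p x : locally_twisted (brick_map p) x.
Proof.
exists (brick_index0 S), 1%g, p; split; first by [].
by move=> y; rewrite brick_index0E twist1.
Qed.

Lemma locally_twisted_brick_map_inv p x : brick p x ->
  locally_twisted (brick_map_inv p) x.
Proof.
move=> px; exists p, 1%g, (brick_index0 S); split=> // y.
by rewrite brick_mapK brick_index0E twist1.
Qed.

Lemma SV_locally_twisted (h : SV a) x : locally_twisted h x.
Proof.
have /SV_predP[I [p [q [g [pE hE]]]]] := valP h.
have [i [ix _]] := pE x.
by exists (p i), (g i), (q i).
Qed.

Lemma locally_twisted_continuous f : (forall x, locally_twisted f x) -> continuous f.
Proof.
move=> fl; apply: cube_continuous => x s k.
have [p [g [q [px fp]]]] := fl x.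
have [l lp] := brick_cylinder px.
(* Beyond the word [q s], the output bit is this input bit; the remaining coordinates in [l] keep
   [y] in the brick. *)
exists ((a g^-1%g s, size (p (a g^-1%g s)) + (k - size (q s)))%N :: l) => y xy.
have py : brick p y by rewrite lp => c cl; apply: xy; rewrite inE cl orbT.
have nlt i j : (i + j < i)%N = false by rewrite ltnNge leq_addr.
have /brickP[x' xE] := px; have /brickP[y' yE] := py.
have := xy _ (mem_head _ _); rewrite xE yE !fp /brick_map /twist /wcat /=.
by rewrite !nlt !addKn => ->.
Qed.

(** Compactness yields finitely many bricks that may overlap. They are refined to the grid of all
    words of one length [m] over one finite set [K] of coordinates, whose cells do partition the
    cube. *)
Lemma locally_twisted_uniform f : (forall x, locally_twisted f x) ->
  exists (I : finType) (p q : I -> brick_index S) (g : I -> G),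
    (forall x, exists! i, brick (p i) x) /\
    (forall i, twist_piece a f (p i) (g i) (q i)).
Proof.
move=> fl; pose P x := projT1 (cid (fl x)).
have Px x : brick (P x) x by rewrite /P; case: cid => p /= [g [q []]].
have Pf x : exists g q, twist_piece a f (P x) g q.
  by rewrite /P; case: cid => p /= [g [q []]]; exists g, q.
have [x|xs cov] := cube_finite_cover (O := fun x => brick (P x)) _ Px.
  by case: (brick_clopen (P x)).
have [F FP] : exists F : X -> seq S, forall x, [set s | P x s <> [::]] = [set` F x].
  have fin x : exists F : seq S, [set s | P x s <> [::]] = [set` F].
    by apply/finite_seqP; exact: brick_word_finite.
  by exists (fun x => projT1 (cid (fin x))) => x; case: cid.
pose K := flatten (map F xs).
pose m := \max_(x <- xs) \max_(s <- F x) size (P x s).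
have sizeP x s : x \in xs -> P x s <> [::] -> s \in K /\ (size (P x s) <= m)%N.
  move=> xxs Pxs; have sF : s \in F x by have : [set` F x] s by rewrite -FP.
  split; first by apply/flattenP; exists (F x) => //; exact: map_f.
  apply: leq_trans (leq_bigmax_seq (F := fun x => \max_(s <- F x) size (P x s)) x xxs isT).
  exact: (leq_bigmax_seq (F := fun s => size (P x s)) s sF isT).
pose I : finType := {ffun seq_sub K -> m.-tuple bool}.
pose w (i : I) s : seq bool := if insub s is Some u then i u else [::].
have wfin i : finite_set [set s | w i s <> [::]].
  apply: (@sub_finite_set _ _ [set` K]); last exact: finite_seq.
  by move=> s /=; rewrite /w; case: insubP.
pose W i := BrickIndex (wfin i).
have wE i (u : seq_sub K) : w i (val u) = i u by rewrite /w valK.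
have WP x : exists! i, brick (W i) x.
  exists [ffun u : seq_sub K => [tuple x (val u) j | j < m]]; split=> [s k|i ix].
    rewrite /= /w; case: insubP => //= u _ <-.
    rewrite ffunE size_map size_enum_ord => km.
    by rewrite -[k]/(nat_of_ord (Ordinal km)) -tnth_nth tnth_mktuple.
  apply/ffunP => u; rewrite ffunE; apply: eq_from_tnth => j.
  rewrite tnth_mktuple (tnth_nth false) -ix /= wE //.
  by rewrite size_tuple.
(* A sample point of the cell selects a brick of the cover; its words are no longer than [m] and
   live over [K], so it contains the entire cell. *)
have sol i : exists t : brick_index S * G * brick_index S,
    (forall x, brick t.1.1 x <-> brick (W i) x) /\ twist_piece a f t.1.1 t.1.2 t.2.
  pose z := brick_map (W i) (fun _ _ => false).
  have iz : brick (W i) z := @brick_map_in S (W i) _.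
  have [y yxs yz] := cov z; have [g [q fy]] := Pf y.
  exists (brick_index_cat (P y) (brick_index_drop (P y) (W i)), g,
    brick_index_cat q (brick_index_act a g (brick_index_drop (P y) (W i)))).
  split=> [x|x] /=; last by rewrite !brick_map_cat fy twist_brick_map.
  rewrite (brick_cat_drop _ yz iz); split=> [[]//|ix]; split=> // s k ks.
  have [|sK sm] := sizeP y s yxs; first by case: (P y s) ks.
  have km : (k < size (W i s))%N.
    rewrite /= -[s]/(val (SeqSub sK)) wE size_tuple; exact: leq_trans ks sm.
  by rewrite yz // -iz // -ix.
exists I, (fun i => (projT1 (cid (sol i))).1.1), (fun i => (projT1 (cid (sol i))).2).
exists (fun i => (projT1 (cid (sol i))).1.2); split=> [x|i]; last first.
  by case: cid => t /= [].
have [i [ix iE]] := WP x; exists i.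
split=> [|j]; case: cid => t /= [tE _]; first exact/tE.
by move/tE/iE.
Qed.

Lemma SV_of_involution f : involutive f -> (forall x, locally_twisted f x) ->
  exists t : SV a, forall x, t x = f x.
Proof.
move=> fK fl; have fc := locally_twisted_continuous fl.
pose h : homeo X := Homeo fK fK fc fc.
have hS : h \in SV_pred a by apply/SV_predP; exact: locally_twisted_uniform.
by exists (MakeSV hS).
Qed.

(** Exchanging two disjoint clopen sets is an involution, so continuity and local form of the
    inverse come for free. *)
Lemma SV_exchange (A B : set X) f f' : clopen A -> clopen B -> A `&` B = set0 ->
  (forall x, A x -> B (f x) /\ f' (f x) = x) ->
  (forall x, B x -> A (f' x) /\ f (f' x) = x) ->
  (forall x, A x -> locally_twisted f x) ->
  (forall x, B x -> locally_twisted f' x) ->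
  exists t : SV a, [/\ forall x, A x -> t x = f x, forall x, B x -> t x = f' x &
    forall x, ~ A x -> ~ B x -> t x = x].
Proof.
move=> cA cB AB fA f'B fl f'l.
have BnA x : B x -> ~ A x by move=> Bx Ax; have : (A `&` B) x by []; rewrite AB.
pose h x := if `[< A x >] then f x else if `[< B x >] then f' x else x.
have hA x : A x -> h x = f x by move=> Ax; rewrite /h asboolT.
have hB x : B x -> h x = f' x by move=> Bx; rewrite /h asboolF ?asboolT //; exact: BnA.
have hN x : ~ A x -> ~ B x -> h x = x by move=> nA nB; rewrite /h !asboolF.
have [|x|t th] := @SV_of_involution h.
- move=> x; have [Ax|nA] := pselect (A x).
    by rewrite (hA _ Ax) hB; case: (fA _ Ax).
  have [Bx|nB] := pselect (B x); last by rewrite !hN.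
  by rewrite (hB _ Bx) hA; case: (f'B _ Bx).
- have [Ax|nA] := pselect (A x).
    apply: (locally_twisted_ext (U := A) (f := f)) => //; first by case: cA.
      by move=> y Ay; rewrite hA.
    exact: fl.
  have [Bx|nB] := pselect (B x).
    apply: (locally_twisted_ext (U := B) (f := f')) => //; first by case: cB.
      by move=> y By; rewrite hB.
    exact: f'l.
  apply: (locally_twisted_ext (U := ~` A `&` ~` B) (f := id)) => //.
  + by have [] := clopen_setI (clopen_setC cA) (clopen_setC cB).
  + by move=> y [nAy nBy]; rewrite hN.
  + exact: locally_twisted_id.
by exists t; split=> x; rewrite th; [exact: hA|exact: hB|exact: hN].
Qed.

Lemma SV_act1 x : SV_val (1%g : SV a) x = x. Proof. by []. Qed.

Lemma SV_actM (g h : SV a) x : SV_val (g * h)%g x = SV_val g (SV_val h x).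
Proof. by []. Qed.

Definition SV_action : group_action (SV a) X :=
  @GroupAction (SV a) X (fun g => SV_val g) SV_act1 SV_actM.

Lemma SV_faithful : faithful_action SV_action.
Proof. by move=> g g1; apply: val_inj; apply: homeo_ext => x; exact: g1. Qed.

Lemma SV_clopen (g : SV a) (A : set X) : clopen A -> clopen [set x | A (g x)].
Proof. by move=> cA; apply: (preimage_clopen cA); exact: homeo_fun_continuous. Qed.

Lemma SV_swap (A : set X) (g : SV a) : clopen A -> (forall x, A x -> ~ A (g x)) ->
  exists t : SV a, [/\ forall x, A x -> t x = g x, forall x, A x -> t (g x) = x &
    forall x, ~ A x -> ~ A ((g^-1%g : SV a) x) -> t x = x].
Proof.
move=> cA gA; pose B := [set x | A ((g^-1%g : SV a) x)].
have gK x : (g^-1%g : SV a) (g x) = x := actVK SV_action g x.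
have gVK x : g ((g^-1%g : SV a) x) = x := actKV SV_action g x.
have [||x Ax|x Bx|x _|x _|t [tA tB tN]] := @SV_exchange A B g (g^-1%g : SV a) cA.
- exact: SV_clopen.
- by apply/seteqP; split=> // x [Ax /gA]; rewrite gVK.
- by split; [rewrite /B /mkset gK|exact: gK].
- by split; [exact: Bx|exact: gVK].
- exact: SV_locally_twisted.
- exact: SV_locally_twisted.
by exists t; split=> // x Ax; rewrite tB ?gK // /B /mkset gK.
Qed.

(** The map [brick_map p] squeezes the whole cube, hence [V], into a brick inside [W]; exchanging
    [V] with its image turns this into a group element. *)
Lemma SV_compress (V W : set X) : clopen V -> clopen W -> W !=set0 ->
  V `&` W = set0 -> exists t : SV a, (forall x, V x -> W (t x)) /\
    forall x, ~ (V `|` W) x -> t x = x.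
Proof.
move=> cV cW [w Ww] VW; have [p [pw pW]] := open_brick (proj1 cW) Ww.
pose B := brick p `&` [set x | V (brick_map_inv p x)].
have cB : clopen B.
  apply: clopenI; first exact: brick_clopen.
  apply: (preimage_clopen cV); apply: cube_continuous => x s k.
  by exists [:: (s, size (p s) + k)%N] => y xy;
    exact: xy (mem_head _ _).
have [|x Vx|x [px Vx]|x _|x [px _]|t [tV tB tN]] :=
    @SV_exchange V B (brick_map p) (brick_map_inv p) cV cB.
- by apply/seteqP; split=> // x [Vx [/pW Wx _]]; have : (V `&` W) x by []; rewrite VW.
- by rewrite brick_mapK; split=> //; split; [exact: brick_map_in|rewrite /= brick_mapK].
- by split=> //; exact: brick_map_invK.
- exact: locally_twisted_brick_map.
- exact: locally_twisted_brick_map_inv.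
exists t; split=> [x Vx|x nx].
  by rewrite tV //; apply/pW/brick_map_in.
by apply: tN => [Vx|[/pW Wx _]]; apply: nx; [left|right].
Qed.

Lemma clopen_separation x y : x != y -> exists D : set X, [/\ clopen D, D x & ~ D y].
Proof.
move=> /eqP xy; have [s [k sk]] : exists s k, y s k <> x s k.
  apply: contrapT => H; apply: xy; apply/funext => s; apply/funext => k.
  by apply: contrapT => sk; apply: H; exists s, k => /esym.
by exists [set z | z s k = x s k]; split=> //; exact: coord_clopen.
Qed.

Lemma clopen_infinite (s0 : S) (U : set X) (l : seq X) :
  clopen U -> U !=set0 -> exists2 x, U x & x \notin l.
Proof.
move=> [oU _] [x Ux]; have [cs csU] := open_cylinder oU Ux.
pose m := (\max_(c <- cs) c.2).+1.
(* A diagonal argument past the coordinates fixed by the cylinder: bit [m + i] at [s0] contradicts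
   the [i]-th entry of [l]. *)
pose y : X := fun s k => if (s == s0) && (m <= k)%N
  then ~~ nth x l (k - m) s k else x s k.
exists y.
  apply: csU => c ccs; rewrite /y ifF // leqNgt ltnS.
  by rewrite (leq_bigmax_seq (F := fun c : S * nat => c.2) c ccs isT) andbF.
apply/negP => yl; have : y s0 (m + index y l)%N = y s0 (m + index y l)%N by [].
rewrite {1}/y eqxx leq_addr /= addKn nth_index //.
by case: (y s0 _).
Qed.

(** If [x0] is not already in the target, compressing the complement of the target into it moves
    [x0] there. *)
Lemma SV_orbit (s0 : S) (x0 : X) (U : set X) (l : seq X) : clopen U -> U !=set0 ->
  exists g : SV a, U (g x0) /\ g x0 \notin l.
Proof.
move=> cU U0; have [y Uy yl] := clopen_infinite s0 l cU U0.
have [|E [cE Ey El]] := clopn_sep_seq (@clopen_setC S) (@clopen_setI S) (@clopen0 X)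
  clopen_separation (k := [:: y]) (l := l).
  by move=> x; rewrite inE => /eqP ->.
have cUE := clopen_setI cU cE.
have UE0 : (U `&` E) !=set0 by exists y; split=> //; apply: Ey; rewrite mem_head.
have [[Ux Ex]|nUE] := pselect ((U `&` E) x0).
  by exists 1%g; split=> //; apply/negP => /El.
have [|t [tW _]] := SV_compress (clopen_setC cUE) cUE UE0; first exact: setICl.
have [Ut Et] := tW _ nUE.
by exists t; split=> //; apply/negP => /El.
Qed.

Lemma SV_uniformly_acyclic (R : realType) (s0 : S) n :
  uniformly_acyclic R SV_action clopen n.
Proof.
apply: (acyclic_all SV_faithful (clopn := clopen)).
- exact: clopen_setC.
- exact: clopen_setI.
- exact: (@clopen0 X).
- exact: SV_clopen.
- exact: clopen_separation.
- exact: (SV_orbit s0 (fun _ _ => false)).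
- exact: SV_swap.
- exact: SV_compress.
Qed.

End LocallyTwisted.

(** * Cochains on finite families *)

Section OrdinalCochains.
Variables (R : realType) (H : groupType).

(** The default 1 is never read on lists of length [n.+1], the only ones that matter. *)
Definition seq_cochain n (c : cochain R H n) (s : seq H) : R :=
  c (fun i => nth 1%g s i).

Definition ord_seq n (x : 'I_n -> H) : seq H := [seq x i | i <- enum 'I_n].

Lemma size_ord_seq n (x : 'I_n -> H) : size (ord_seq x) = n.
Proof. by rewrite size_map size_enum_ord. Qed.

Lemma nth_ord_seq n (x : 'I_n -> H) (i : 'I_n) : nth 1%g (ord_seq x) i = x i.
Proof. by rewrite (nth_map i) ?size_enum_ord // nth_ord_enum. Qed.

Lemma seq_cochainK n (c : cochain R H n) x : seq_cochain c (ord_seq x) = c x.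
Proof. by congr c; apply/funext => i; rewrite nth_ord_seq. Qed.

Lemma ord_seq_nth n (s : seq H) : size s = n ->
  ord_seq (fun i : 'I_n => nth 1%g s i) = s.
Proof.
move=> sn; apply: (@eq_from_nth _ 1%g) => [|i]; rewrite size_ord_seq // => i_n.
by rewrite -[i]/(nat_of_ord (Ordinal i_n)) nth_ord_seq.
Qed.

Lemma ord_seqS n (x : 'I_n.+1 -> H) :
  ord_seq x = x ord0 :: ord_seq (x \o lift ord0).
Proof. by rewrite /ord_seq enum_ordSl /= -map_comp. Qed.

Lemma cobd_ord_seq n (f : seq H -> R) (x : 'I_n.+1 -> H) :
  cobd f (ord_seq x) = \sum_(i < n.+1) (-1) ^+ i * f (ord_seq (x \o lift i)).
Proof.
elim: n f x => [|n IH] f x.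
  rewrite ord_seqS big_ord_recl big_ord0 /= expr0 mul1r addr0.
  have -> (y : 'I_0 -> H) : ord_seq y = [::] by apply: size0nil; exact: size_ord_seq.
  by rewrite /= subr0.
rewrite ord_seqS big_ord_recl /= expr0 mul1r IH -sumrN; congr (_ + _).
apply: eq_bigr => i _; rewrite exprS mulN1r mulNr; congr (- (_ * f _)).
rewrite [RHS]ord_seqS /=; congr (_ :: _); first by congr x; exact: val_inj.
by congr ord_seq; apply/funext => j /=; congr x; apply: val_inj; rewrite /= /bump /= addnCA.
Qed.

Lemma coboundaryE n (c : cochain R H n) x :
  coboundary c x = cobd (seq_cochain c) (ord_seq x).
Proof.
rewrite cobd_ord_seq; apply: eq_bigr => i _; congr (_ * _).
by rewrite seq_cochainK.
Qed.

Lemma coboundaryD n (b c : cochain R H n) :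
  coboundary (b + c) = coboundary b + coboundary c.
Proof.
apply/funext => x.
suff : coboundary (b + c) x = coboundary b x + coboundary c x by [].
rewrite /coboundary -big_split; apply: eq_bigr => i _ /=.
by rewrite -mulrDr.
Qed.

Lemma boundedly_acyclicP :
  (forall n c, @bounded_cocycles R H n.+1 c -> @bounded_coboundaries R H n.+1 c) ->
  boundedly_acyclic R H.
Proof.
move=> acyc [//|n] _.
have cob0 : @bounded_coboundaries R H n.+1 0.
  exists 0; first by split=> //; exists 0 => x; rewrite normr0.
  by apply/funext => x; rewrite /coboundary big1 // => i _; rewrite mulr0.
have cobD (b c : cochain R H n.+1) : @bounded_coboundaries R H n.+1 b ->
    @bounded_coboundaries R H n.+1 c -> @bounded_coboundaries R H n.+1 (b + c).
  move=> [b' [b'I [M b'M]] <-] [c' [c'I [N c'N]] <-].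
  exists (b' + c'); last exact: coboundaryD.
  split=> [g x|]; first by rewrite [LHS]/(b' _ + c' _) b'I c'I.
  exists (M + N) => x; rewrite (le_trans (ler_normD _ _)) // lerD //.
have cobN (b : cochain R H n.+1) : @bounded_coboundaries R H n.+1 b ->
    @bounded_coboundaries R H n.+1 (- b).
  move=> [b' [b'I [M b'M]] <-]; exists (- b').
    split=> [g x|]; first by rewrite [LHS]/(- b' _) b'I.
    by exists M => x; rewrite normrN.
  apply/funext => x.
  suff : coboundary (- b') x = - coboundary b' x by [].
  rewrite /coboundary -sumrN.
  by apply: eq_bigr => i _; rewrite -mulrN.
have class0 c : @bounded_coboundaries R H n.+1 c -> bounded_class c = bounded_class 0.
  move=> cC; apply/seteqP; split=> _ [b bC <-].
    by exists (c + b); [exact: cobD|rewrite add0r].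
  exists (b - c); first exact/cobD/cobN.
  by rewrite add0r addrC subrK.
apply/seteqP; split=> [_ [c cC <-]|_ ->]; first exact/class0/acyc.
exists 0 => //; split; first by split=> //; exists 0 => x; rewrite normr0.
by apply/funext => x; rewrite /coboundary big1 // => i _; rewrite mulr0.
Qed.

Lemma bounded_coboundaries_seq n (c : cochain R H n.+1) b M :
  inv_cochain (fun=> True) n.+1 M b ->
  (forall s, size s = n.+2 -> seq_cochain c s = cobd b s) ->
  @bounded_coboundaries R H n.+1 c.
Proof.
move=> [bM bI] cb; exists (fun x => b (ord_seq x)).
  split=> [g x|]; last by exists M => x; rewrite bM // size_ord_seq.
  rewrite -[RHS](bI g) ?size_ord_seq // /ord_seq -map_comp.
  by congr b.
apply/funext => x; rewrite -(seq_cochainK c) cb ?size_ord_seq // coboundaryE.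
apply: (cobd_ext_size (n := n.+1)); first exact: size_ord_seq.
by move=> u un; rewrite /seq_cochain ord_seq_nth.
Qed.

Lemma bounded_cocycles_seq n (c : cochain R H n) : @bounded_cocycles R H n c ->
  cocycle n.+1 (seq_cochain c) /\
  exists M, inv_cochain (fun=> True) n.+1 M (seq_cochain c).
Proof.
move=> [[cI [M cM]] c0]; split=> [s sn|].
  by rewrite -(ord_seq_nth sn) -coboundaryE c0.
exists M; split=> [s _|h s _ sn]; first exact: cM.
rewrite -[RHS](cI h); congr c; apply/funext => i.
by rewrite (nth_map 1%g) // sn.
Qed.

End OrdinalCochains.

Theorem theorem0p11 (R : realType) (G : groupType) (S : Type)
    (a : group_action G S) (ScountP : countable [set: S])
    (aP : faithful_action a) :
  boundedly_acyclic R (SV a).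
Proof.
apply: boundedly_acyclicP => n c /bounded_cocycles_seq[cc [M cI]].
(* For empty [S] the cube is a single point and the group is trivial, so the cone with vertex 1 is
   an invariant primitive. *)
have [[s0]|S0] := pselect (inhabited S); last first.
  have SV1 (g : SV a) : g = 1%g.
    apply: val_inj; apply: homeo_ext => x; apply/funext => s.
    by case: S0.
  apply: (@bounded_coboundaries_seq _ _ _ _ (fun s => seq_cochain c (1%g :: s)) M).
    case: cI => cM cI; split=> [s sn|h s _ sn]; first by rewrite cM //= sn.
    by rewrite (SV1 h) (eq_map (@mul1g _)) map_id.
  by move=> s sn; exact: cocycle_cone cc sn.
pose S' : choiceType := HB.pack S (gen_eqMixin S) (gen_choiceMixin S).
have [M' acyc] := @SV_uniformly_acyclic S' G a R s0 n.+2 M.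
(* Every element is supported in the whole cube, and degree [n.+1] corresponds to lists of length
   [n.+2]. *)
have [||b bI cb] := acyc setT (seq_cochain c) (@clopenT _).
- by apply: invcW cI.
- exact: cc.
apply: (bounded_coboundaries_seq (b := b) (M := M')) cb.
by apply: invcW bI => h _ x; case.
Qed.
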